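(* The system $$\mathfrak r^1_t+(\mathfrak r^1+\mathfrak r^2+1)\mathfrak r^1_x=0,\qquad \mathfrak r^2_t+(\mathfrak r^1+\mathfrak r^2-1)\mathfrak r^2_x=0,\qquad \mathfrak r^3_t+(\mathfrak r^1+\mathfrak r^2)\mathfrak r^3_x=0$$ for unknown functions $\mathfrak r^1,\mathfrak r^2,\mathfrak r^3$ of $(t,x)$ possesses a family of nontrivial conservation laws of arbitrarily high order with conserved currents $$\mathrm C_1(\Omega)=\left(e^{\mathfrak r^1-\mathfrak r^2}\Omega,\ (\mathfrak r^1+\mathfrak r^2)e^{\mathfrak r^1-\mathfrak r^2}\Omega\right)$$ parameterized by an arbitrary function $\Omega$ of a finite, but unspecified number of $\omega^\iota=(e^{\mathfrak r^2-\mathfrak r^1}\mathrm D_x)^\iota\mathfrak r^3$, $\iota\in\mathbb N_0$.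
   Context: $\mathrm D_t$ and $\mathrm D_x$ are the total derivative operators. A conserved current of the system is a pair $(\rho,\sigma)$ of differential functions (density and flux) with $\mathrm D_t\rho+\mathrm D_x\sigma=0$ on all solutions of the system. Two conserved currents are equivalent if they differ by a trivial one (a sum of a null divergence and a pair vanishing on solutions); conservation laws are the equivalence classes, and a conservation law is nontrivial if its class is not that of the zero current. The order of a conservation law is the minimal order of (densities of) conserved currents representing it. *)

(* Defs.v *)
From Stdlib Require Import Reals Arith.
From Coquelicot Require Import Coquelicot.
Open Scope R_scope.

(** ** Smooth functions of finitely many of a family of real variables

    The variables are labelled by a type [I] with decidable equality; a point
    is a map [I -> R]. *)

Definition upd {I : Type} (dec : forall a b : I, {a = b} + {a <> b})
  (z : I -> R) (v : I) (s : R) : I -> R :=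
  fun w => if dec w v then s else z w.

Definition partial {I : Type} (dec : forall a b : I, {a = b} + {a <> b})
  (v : I) (F : (I -> R) -> R) : (I -> R) -> R :=
  fun z => Derive (fun s => F (upd dec z v s)) (z v).

Definition depends_only {I : Type} (S : I -> Prop) (F : (I -> R) -> R) : Prop :=
  forall z w : I -> R, (forall v, S v -> z v = w v) -> F z = F w.

(** Analogue of [ex_diff_n] for functions on [I -> R].  Continuity refers to
    the uniform structure of [fct_UniformSpace] (sup-distance); for a function
    depending on finitely many variables only, which is the sole case used
    below, this is joint continuity in these variables. *)
Fixpoint of_class_C {I : Type} (dec : forall a b : I, {a = b} + {a <> b})
  (n : nat) (F : (I -> R) -> R) : Prop :=
  (forall z : I -> R, continuous F z) /\
  match n with
  | O => True
  | S n' => forall v : I,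
      (forall z : I -> R, ex_derive (fun s : R => F (upd dec z v s)) (z v)) /\
      of_class_C dec n' (partial dec v F)
  end.

Definition smooth {I : Type} (dec : forall a b : I, {a = b} + {a <> b})
  (F : (I -> R) -> R) : Prop :=
  forall n, of_class_C dec n F.

(** ** The jet space and differential functions *)

Inductive unknown : Set := r1 | r2 | r3.

(** [Jr i k l] is the derivative of the i-th unknown, k times with respect to
    t and l times with respect to x. *)
Inductive jetvar : Set :=
  | Jt : jetvar
  | Jx : jetvar
  | Jr : unknown -> nat -> nat -> jetvar.

Definition unknown_eq_dec (a b : unknown) : {a = b} + {a <> b}.
Proof. decide equality. Defined.

Definition jetvar_eq_dec (a b : jetvar) : {a = b} + {a <> b}.
Proof.
decide equality; [apply Nat.eq_dec | apply Nat.eq_dec | apply unknown_eq_dec].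
Defined.

Definition jet : Type := jetvar -> R.

Definition jet_le (n : nat) (v : jetvar) : Prop :=
  match v with
  | Jt => True
  | Jx => True
  | Jr _ k l => (k + l <= n)%nat
  end.

Definition order_le (n : nat) (F : jet -> R) : Prop := depends_only (jet_le n) F.

(** Functions of (t,x) alone are given order 0. *)
Definition has_order (F : jet -> R) (n : nat) : Prop :=
  order_le n F /\ forall m, order_le m F -> (n <= m)%nat.

Definition diff_function (F : jet -> R) : Prop :=
  smooth jetvar_eq_dec F /\ exists n, order_le n F.

(** ** Total derivatives *)

(** The sum of [a i k l] over all unknowns i and all k, l, grouped by k + l. *)
Definition jet_sum (a : unknown -> nat -> nat -> R) : R :=
  Series (fun m =>
    sum_n (fun k => a r1 k (m - k)%nat + a r2 k (m - k)%nat + a r3 k (m - k)%nat) m).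

(** On a differential function all but finitely many terms of the sums vanish,
    so that [Series] is a finite sum. *)
Definition total_Dt (F : jet -> R) : jet -> R := fun z =>
  partial jetvar_eq_dec Jt F z +
  jet_sum (fun i k l => z (Jr i (S k) l) * partial jetvar_eq_dec (Jr i k l) F z).

Definition total_Dx (F : jet -> R) : jet -> R := fun z =>
  partial jetvar_eq_dec Jx F z +
  jet_sum (fun i k l => z (Jr i k (S l)) * partial jetvar_eq_dec (Jr i k l) F z).

(** ** The system and its solutions *)

Definition velocity (i : unknown) (z : jet) : R :=
  match i with
  | r1 => z (Jr r1 0 0) + z (Jr r2 0 0) + 1
  | r2 => z (Jr r1 0 0) + z (Jr r2 0 0) - 1
  | r3 => z (Jr r1 0 0) + z (Jr r2 0 0)
  end.

Definition system (i : unknown) (z : jet) : R :=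
  z (Jr i 1 0) + velocity i z * z (Jr i 0 1).

Definition prolong (u : unknown -> R -> R -> R) (t x : R) : jet := fun v =>
  match v with
  | Jt => t
  | Jx => x
  | Jr i k l => partial_derive k l (u i) t x
  end.

(** Solutions are local: smooth on an arbitrary open subset of the (t,x)-plane;
    the values of [u] outside [U] are irrelevant. *)
Definition is_solution (U : R * R -> Prop) (u : unknown -> R -> R -> R) : Prop :=
  open U /\
  (forall i t x, U (t, x) -> forall n, ex_diff_n (u i) n t x) /\
  (forall i t x, U (t, x) -> system i (prolong u t x) = 0).

Definition vanishes_on_solutions (F : jet -> R) : Prop :=
  forall U u, is_solution U u ->
  forall t x, U (t, x) -> F (prolong u t x) = 0.

(** ** Conserved currents and conservation laws *)

(** (density, flux) *)
Definition current : Type := ((jet -> R) * (jet -> R))%type.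

Definition diff_current (C : current) : Prop :=
  diff_function (fst C) /\ diff_function (snd C).

Definition total_div (C : current) : jet -> R :=
  fun z => total_Dt (fst C) z + total_Dx (snd C) z.

Definition conserved_current (C : current) : Prop :=
  diff_current C /\ vanishes_on_solutions (total_div C).

Definition null_divergence (C : current) : Prop :=
  diff_current C /\ forall z, total_div C z = 0.

Definition current_vanishing_on_solutions (C : current) : Prop :=
  diff_current C /\
  vanishes_on_solutions (fst C) /\ vanishes_on_solutions (snd C).

Definition trivial_current (C : current) : Prop :=
  exists N Z : current,
    null_divergence N /\ current_vanishing_on_solutions Z /\
    (forall z, fst C z = fst N z + fst Z z) /\
    (forall z, snd C z = snd N z + snd Z z).

Definition equivalent_currents (C C' : current) : Prop :=
  trivial_current (fun z => fst C z - fst C' z, fun z => snd C z - snd C' z).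

Definition zero_current : current := (fun _ => 0, fun _ => 0).

Definition nontrivial_law (C : current) : Prop :=
  ~ equivalent_currents C zero_current.

(** The conservation law containing [C] has order [n]: minimum of the orders of
    the densities of the conserved currents in the class of [C]. *)
Definition law_order (C : current) (n : nat) : Prop :=
  (exists C', conserved_current C' /\ equivalent_currents C C' /\
              has_order (fst C') n) /\
  (forall C' m, conserved_current C' -> equivalent_currents C C' ->
              has_order (fst C') m -> (n <= m)%nat).

(** ** The family of conserved currents *)

Fixpoint omega (iota : nat) : jet -> R :=
  match iota with
  | O => fun z => z (Jr r3 0 0)
  | S j => fun z => exp (z (Jr r2 0 0) - z (Jr r1 0 0)) * total_Dx (omega j) z
  end.

(** Smooth functions of finitely many of the arguments omega^0, omega^1, etc. *)
Definition admissible_Omega (Om : (nat -> R) -> R) : Prop :=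
  smooth Nat.eq_dec Om /\ exists n, depends_only (fun j => (j <= n)%nat) Om.

Definition current_C1 (Om : (nat -> R) -> R) : current :=
  (fun z => exp (z (Jr r1 0 0) - z (Jr r2 0 0)) * Om (fun j => omega j z),
   fun z => (z (Jr r1 0 0) + z (Jr r2 0 0)) *
            exp (z (Jr r1 0 0) - z (Jr r2 0 0)) * Om (fun j => omega j z)).

(* Main.v *)
Require Import Defs.
From Stdlib Require Import Reals Arith List Lia Lra Psatz.
From Stdlib Require Import FunctionalExtensionality Classical ClassicalEpsilon.
From Coquelicot Require Import Coquelicot.
Import ListNotations.

(** Along a solution a total derivative of a differential function is the partial
    derivative of its evaluation (chain rule).  The operator
    e^(r2-r1) D_x commutes with D_t + (r1+r2) D_x on solutions and r3 is annihilated
    by the latter, hence so are all omega^j; together with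
    D_t e^(r1-r2) + D_x ((r1+r2) e^(r1-r2)) = 0 this makes C_1(Omega) conserved.

    For Omega = (omega^K)^2 the order is bounded from below by testing on the
    solutions r1 = r2 = 0, r3 = f(x), where the density is (f^(K))^2.  If f is flat at
    0 and 1, the integral over [0,1] of the density of a null divergence does not depend
    on f (deform f to 0 in time, off the solution set), so every equivalent density G
    satisfies int (f^(K))^2 = int (G[f] - G[0]).  If G has order below K, take
    f = nu^(-K) phi(x) sin(nu x + c): the derivatives of f of order below K tend to 0 as nu
    grows, and so does the right-hand side, whereas the left-hand sides for c = 0 and
    c = pi/2 add up to int phi^2 in the limit. *)

(** * Functions of finitely many coordinates *)

(** A lower bound on the order has to exclude all equivalent densities at once, and the null
    divergence by which two of them differ is given only through an identity on jet space, without a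
    potential. Since that identity holds at every jet, it can be evaluated along functions that do
    not solve the system, which is what makes the deformation in time legitimate. The part vanishing
    on solutions disappears because both ends of the comparison, f and 0, are static solutions. The
    term G[0] is subtracted because densities and fluxes may depend on t and x explicitly, so that
    the zero function need not give zero. Flatness of f matters only up to the order of the null
    divergence, which is fixed before f is chosen; hence polynomials can serve as cut-offs in x and
    in t. *)

Definition sum_over {I : Type} (l : list I) (f : I -> R) : R :=
  fold_right (fun v acc => f v + acc) 0 l.

Lemma sum_over_ext {I : Type} (l : list I) (f g : I -> R) :
  (forall v, In v l -> f v = g v) -> sum_over l f = sum_over l g.
Proof.
induction l as [|v l IH]; simpl; intros H; [reflexivity|].
rewrite (H v), IH; auto.
Qed.

Lemma sum_over_cons {I : Type} (v : I) (l : list I) (f : I -> R) :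
  sum_over (v :: l) f = f v + sum_over l f.
Proof. reflexivity. Qed.

Lemma sum_over_app {I : Type} (l l' : list I) (f : I -> R) :
  sum_over (l ++ l') f = sum_over l f + sum_over l' f.
Proof. induction l as [|v l IH]; simpl; [|rewrite IH]; ring. Qed.

Lemma sum_over_flat_map {I J : Type} (l : list J) (g : J -> list I) (f : I -> R) :
  sum_over (flat_map g l) f = sum_over l (fun j => sum_over (g j) f).
Proof.
induction l as [|v l IH]; simpl; [reflexivity|].
now rewrite sum_over_app, IH.
Qed.

Lemma sum_over_seq (a : nat -> R) (n : nat) :
  sum_over (seq 0 (S n)) a = sum_n a n.
Proof.
induction n as [|n IH].
- rewrite sum_O; simpl; ring.
- rewrite seq_S, sum_over_app, IH, sum_Sn; simpl; unfold plus; simpl; ring.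
Qed.

Lemma NoDup_flat_map_disjoint {I J : Type} (l : list J) (g : J -> list I) :
  NoDup l -> (forall j, NoDup (g j)) ->
  (forall i j v, In v (g i) -> In v (g j) -> i = j) ->
  NoDup (flat_map g l).
Proof.
intros Hl Hg Hd; induction Hl as [|j l Hj Hl IH]; simpl; [constructor|].
apply NoDup_app; auto.
intros v Hv Hv'; apply in_flat_map in Hv'; destruct Hv' as [i [Hi Hvi]].
apply Hj; now rewrite (Hd j i v).
Qed.

Lemma upd_same {I : Type} (dec : forall a b : I, {a = b} + {a <> b})
  (z : I -> R) (v : I) : upd dec z v (z v) = z.
Proof.
apply functional_extensionality; intros w; unfold upd.
destruct (dec w v); congruence.
Qed.

Lemma upd_upd {I : Type} (dec : forall a b : I, {a = b} + {a <> b})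
  (z : I -> R) (v : I) (s r : R) : upd dec (upd dec z v s) v r = upd dec z v r.
Proof.
apply functional_extensionality; intros w; unfold upd.
destruct (dec w v); congruence.
Qed.

Lemma upd_eq {I : Type} (dec : forall a b : I, {a = b} + {a <> b})
  (z : I -> R) (v : I) (s : R) : upd dec z v s v = s.
Proof. unfold upd; destruct (dec v v); congruence. Qed.

Lemma upd_neq {I : Type} (dec : forall a b : I, {a = b} + {a <> b})
  (z : I -> R) (v w : I) (s : R) : w <> v -> upd dec z v s w = z w.
Proof. unfold upd; destruct (dec w v); congruence. Qed.

Lemma depends_only_weaken {I : Type} (S T : I -> Prop) (F : (I -> R) -> R) :
  (forall v, S v -> T v) -> depends_only S F -> depends_only T F.
Proof. intros H HF z w E; apply HF; auto. Qed.

Lemma depends_only_partial {I : Type} (dec : forall a b : I, {a = b} + {a <> b})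
  (S : I -> Prop) (v : I) (F : (I -> R) -> R) :
  depends_only S F -> depends_only S (partial dec v F).
Proof.
intros HF z w E; unfold partial.
destruct (classic (S v)) as [Hv|Hv].
- rewrite (E v Hv); f_equal.
  apply functional_extensionality; intros s; apply HF; intros a Ha.
  unfold upd; destruct (dec a v); auto.
- assert (H : forall y r, Derive (fun s => F (upd dec y v s)) r = 0).
  { intros y r; rewrite (Derive_ext _ (fun _ => F y)), Derive_const; [reflexivity|].
    intros t; apply HF; intros a Ha; apply upd_neq; congruence. }
  now rewrite !H.
Qed.

Lemma partial_off_support {I : Type} (dec : forall a b : I, {a = b} + {a <> b})
  (S : I -> Prop) (v : I) (F : (I -> R) -> R) :
  depends_only S F -> ~ S v -> forall z, partial dec v F z = 0.
Proof.
intros HF Hv z; unfold partial.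
rewrite (Derive_ext _ (fun _ => F z)), Derive_const; [reflexivity|].
intros t; apply HF; intros a Ha; apply upd_neq; congruence.
Qed.

(** Passes from the sup-distance on all coordinates to closeness in the coordinates of [l]: a point
    close to [z] there can be reset to [z] elsewhere without changing [F]. *)
Lemma finite_dep_continuous {I : Type} (dec : forall a b : I, {a = b} + {a <> b})
  (l : list I) (F : (I -> R) -> R) (z : I -> R) :
  depends_only (fun v => In v l) F -> continuous F z ->
  forall eps : posreal, exists d : posreal, forall w : I -> R,
    (forall v, In v l -> Rabs (w v - z v) < d) -> Rabs (F w - F z) < eps.
Proof.
intros HF HC eps.
destruct (proj1 (filterlim_locally F (F z)) HC eps) as [d Hd].
exists d; intros w Hw.
set (w' := fun v => if in_dec dec v l then w v else z v).
assert (E : F w = F w').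
{ apply HF; intros v Hv; unfold w'; destruct (in_dec dec v l); tauto. }
rewrite E; apply Hd; intros v.
unfold w'; destruct (in_dec dec v l); [now apply Hw | apply ball_center].
Qed.

Lemma locally_forall_list {I : Type} {X : UniformSpace} (l : list I)
  (P : I -> X -> Prop) (x : X) :
  (forall v, In v l -> locally x (P v)) ->
  locally x (fun y => forall v, In v l -> P v y).
Proof.
induction l as [|v l IH]; intros H.
- apply filter_forall; intros y w [].
- generalize (filter_and _ _ (H v (in_eq v l)) (IH (fun w Hw => H w (in_cons v w l Hw)))).
  apply filter_imp; intros y [Hv Hl] w [<-|Hw]; auto.
Qed.

Lemma continuous_comp_finite {I : Type} (dec : forall a b : I, {a = b} + {a <> b})
  {X : UniformSpace} (l : list I) (F : (I -> R) -> R) (g : X -> I -> R) (x : X) :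
  depends_only (fun v => In v l) F -> continuous F (g x) ->
  (forall v, In v l -> continuous (fun y => g y v) x) ->
  continuous (fun y => F (g y)) x.
Proof.
intros HF HC Hg; apply filterlim_locally; intros eps.
destruct (finite_dep_continuous dec l F (g x) HF HC eps) as [d Hd].
assert (H : locally x (fun y => forall v, In v l -> Rabs (g y v - g x v) < d)).
{ apply (locally_forall_list l (fun v y => Rabs (g y v - g x v) < d)); intros v Hv.
  exact (proj1 (filterlim_locally (fun y => g y v) (g x v)) (Hg v Hv) d). }
revert H; apply filter_imp; intros y Hy; now apply Hd.
Qed.

(** * The chain rule *)

Lemma is_derive_continuous (f : R -> R) (x l : R) :
  is_derive f x l -> continuous f x.
Proof. intros H; apply (ex_derive_continuous f); now exists l. Qed.

(** The slope [c] is only asked to multiply the increment of [g]; nothing is divided by that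
    increment, which may vanish arbitrarily close to [t0]. In the chain rule [c] comes from the mean
    value theorem. *)
Lemma is_derive_quotient (D g : R -> R) (t0 c0 d : R) :
  (forall eps : posreal, locally t0 (fun t =>
     exists c, Rabs (c - c0) <= eps /\ D t = c * (g t - g t0))) ->
  is_derive g t0 d -> is_derive D t0 (c0 * d).
Proof.
intros HD Hg.
apply is_derive_Reals; apply is_derive_Reals in Hg.
assert (HD0 : D t0 = 0).
{ destruct (locally_singleton _ _ (HD (mkposreal 1 Rlt_0_1))) as [c [_ E]].
  rewrite E; ring. }
intros eps Heps.
(* With q the difference quotient of [g], the error is (c - c0)(q - d) + (c - c0) d + c0 (q - d).
   For |c - c0| <= e and |q - d| < min(e, 1) it is at most e (1 + |d| + |c0|) = eps / 2, and the
   spare half makes the bound strict. *)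
set (e := eps / (2 * (1 + Rabs d + Rabs c0))).
assert (Hp : 0 < 1 + Rabs d + Rabs c0)
  by (generalize (Rabs_pos d) (Rabs_pos c0); lra).
assert (He : 0 < e) by (apply Rdiv_lt_0_compat; lra).
set (e1 := Rmin e 1).
assert (He1 : 0 < e1) by (apply Rmin_pos; lra).
destruct (Hg e1 He1) as [d1 Hd1].
destruct (HD (mkposreal e He)) as [d2 Hd2].
assert (Hd : 0 < Rmin d1 d2) by (apply Rmin_pos; apply cond_pos).
exists (mkposreal _ Hd); intros h Hh Hhd; simpl in Hhd.
assert (H1 := Hd1 h Hh (Rlt_le_trans _ _ _ Hhd (Rmin_l _ _))).
destruct (Hd2 (t0 + h)) as [c [Hc E]].
{ unfold ball; simpl; unfold AbsRing_ball, abs, minus, plus, opp; simpl.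
  replace (t0 + h + - t0) with h by ring.
  exact (Rlt_le_trans _ _ _ Hhd (Rmin_r _ _)). }
simpl in Hc; rewrite HD0, E.
set (q := (g (t0 + h) - g t0) / h) in *.
replace ((c * (g (t0 + h) - g t0) - 0) / h) with (c * q) by (unfold q; field; auto).
replace (c * q - c0 * d) with ((c - c0) * (q - d) + ((c - c0) * d + c0 * (q - d))) by ring.
assert (He1e : e1 <= e) by apply Rmin_l.
assert (He11 : e1 <= 1) by apply Rmin_r.
eapply Rle_lt_trans; [apply Rabs_triang|].
eapply Rle_lt_trans; [apply Rplus_le_compat_l, Rabs_triang|].
rewrite !Rabs_mult.
assert (HE : e * (1 + Rabs d + Rabs c0) = eps / 2) by (unfold e; field; lra).
pose proof (Rabs_pos (c - c0)); pose proof (Rabs_pos (q - d)).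
pose proof (Rabs_pos d); pose proof (Rabs_pos c0).
assert (Rabs (c - c0) * Rabs (q - d) <= e * 1) by (apply Rmult_le_compat; lra).
assert (Rabs (c - c0) * Rabs d <= e * Rabs d) by (apply Rmult_le_compat_r; lra).
assert (Rabs c0 * Rabs (q - d) <= Rabs c0 * e) by (apply Rmult_le_compat_l; lra).
lra.
Qed.

(** The hypothesis speaks of the derivative at [z v] only; taking the point [upd dec z v s] as the
    base point moves it to an arbitrary [s]. *)
Lemma is_derive_upd {I : Type} (dec : forall a b : I, {a = b} + {a <> b})
  (v : I) (F : (I -> R) -> R) :
  (forall z, ex_derive (fun s => F (upd dec z v s)) (z v)) ->
  forall z s, is_derive (fun r => F (upd dec z v r)) s (partial dec v F (upd dec z v s)).
Proof.
intros H z s.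
assert (E : forall r, F (upd dec (upd dec z v s) v r) = F (upd dec z v r))
  by (intros r; now rewrite upd_upd).
assert (H' : ex_derive (fun r => F (upd dec z v r)) s).
{ apply (ex_derive_ext _ _ _ E).
  generalize (H (upd dec z v s)); now rewrite upd_eq. }
unfold partial; rewrite (Derive_ext _ _ _ E), upd_eq; now apply Derive_correct.
Qed.

(* The coordinates are frozen one at a time: [g] is compared with the path whose
   coordinate [v] is kept at its value for [t0], the difference being controlled
   by the mean value theorem in the direction [v]. *)
Lemma chain_rule_aux {I : Type} (dec : forall a b : I, {a = b} + {a <> b})
  (L : list I) (F : (I -> R) -> R) :
  depends_only (fun v => In v L) F ->
  (forall v z, ex_derive (fun s => F (upd dec z v s)) (z v)) ->
  (forall v z, continuous (partial dec v F) z) ->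
  forall (l : list I) (g : R -> I -> R) (t0 : R) (d : I -> R),
  NoDup l ->
  (forall v, In v l -> is_derive (fun t => g t v) t0 (d v)) ->
  (forall v t, In v L -> ~ In v l -> g t v = g t0 v) ->
  is_derive (fun t => F (g t)) t0 (sum_over l (fun v => d v * partial dec v F (g t0))).
Proof.
intros HL HD HC l.
induction l as [|v l IH]; intros g t0 d Hl Hg Hout.
- apply (is_derive_ext (fun _ => F (g t0))); [|apply @is_derive_const].
  intros t; apply HL; intros v Hv; symmetry; apply Hout; auto.
- inversion Hl as [|? ? Hvl Hl']; subst.
  set (g' := fun t => upd dec (g t) v (g t0 v)).
  assert (E0 : g' t0 = g t0) by apply upd_same.
  assert (H1 : is_derive (fun t => F (g' t)) t0
                 (sum_over l (fun w => d w * partial dec w F (g t0)))).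
  { rewrite <- E0; apply IH; auto.
    - intros w Hw; apply (is_derive_ext (fun t => g t w)).
      + intros t; symmetry; apply upd_neq; congruence.
      + apply Hg; now right.
    - intros w t HwL Hw; unfold g'.
      destruct (dec w v) as [->|Hwv]; [now rewrite !upd_eq|].
      rewrite !upd_neq by auto; apply Hout; auto.
      intros [->|?]; auto. }
  assert (Hcont : forall w, In w L -> continuous (fun t => g t w) t0).
  { intros w Hw; destruct (in_dec dec w (v :: l)) as [Hi|Hi].
    - now apply (is_derive_continuous _ _ (d w)), Hg.
    - apply (continuous_ext (fun _ => g t0 w)); [|apply continuous_const].
      intros t; symmetry; now apply Hout. }
  assert (H2 : is_derive (fun t => F (g t) - F (g' t)) t0
                 (partial dec v F (g t0) * d v)).
  { apply (is_derive_quotient _ (fun t => g t v)); [|apply Hg; now left].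
    intros eps.
    destruct (finite_dep_continuous dec L _ (g t0)
                (depends_only_partial dec _ v F HL) (HC v (g t0)) eps) as [de Hde].
    assert (Hn : locally t0 (fun t => forall w, In w (v :: L) -> Rabs (g t w - g t0 w) < de)).
    { apply (locally_forall_list (v :: L) (fun w t => Rabs (g t w - g t0 w) < de)).
      intros w Hw.
      assert (Hc : continuous (fun t => g t w) t0).
      { destruct Hw as [<-|Hw]; [|auto].
        apply (is_derive_continuous _ _ (d v)), Hg; now left. }
      exact (proj1 (filterlim_locally (fun y => g y w) (g t0 w)) Hc de). }
    revert Hn; apply filter_imp; intros t Ht.
    destruct (MVT_gen (fun s => F (upd dec (g t) v s)) (g t0 v) (g t v)
                (fun s => partial dec v F (upd dec (g t) v s))) as [c [Hc Hm]].
    - intros s _; now apply is_derive_upd.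
    - intros s _; apply continuity_pt_filterlim.
      eapply is_derive_continuous; now apply is_derive_upd.
    - exists (partial dec v F (upd dec (g t) v c)); split.
      + left; apply Hde; intros w Hw.
        destruct (dec w v) as [->|Hwv].
        * rewrite upd_eq.
          assert (Hv := Ht v (in_eq _ _)).
          revert Hv Hc; unfold Rabs, Rmin, Rmax.
          repeat destruct Rcase_abs; repeat destruct Rle_dec; lra.
        * rewrite upd_neq by auto; apply Ht; now right.
      + rewrite <- Hm, upd_same; reflexivity. }
  simpl.
  apply (is_derive_ext (fun t => plus (F (g t) - F (g' t)) (F (g' t)))).
  { intros t; unfold plus; simpl; ring. }
  rewrite (Rmult_comm (d v)).
  now apply @is_derive_plus.
Qed.

(** * Closure properties of the classes C^n *)

Lemma of_class_C_continuous {I : Type} (dec : forall a b : I, {a = b} + {a <> b}) n F :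
  of_class_C dec n F -> forall z, continuous F z.
Proof. destruct n; simpl; tauto. Qed.

Lemma of_class_C_pred {I : Type} (dec : forall a b : I, {a = b} + {a <> b}) n :
  forall F, of_class_C dec (S n) F -> of_class_C dec n F.
Proof.
induction n as [|n IH]; intros F [Hc H]; split; auto.
intros v; destruct (H v); auto.
Qed.

Lemma of_class_C_le {I : Type} (dec : forall a b : I, {a = b} + {a <> b}) n m F :
  (n <= m)%nat -> of_class_C dec m F -> of_class_C dec n F.
Proof. induction 1; auto; intros; apply IHle; now apply of_class_C_pred. Qed.

Lemma smooth_partial {I : Type} (dec : forall a b : I, {a = b} + {a <> b}) v F :
  smooth dec F -> smooth dec (partial dec v F).
Proof. intros H n; apply (H (S n)). Qed.

Lemma chain_rule {I : Type} (dec : forall a b : I, {a = b} + {a <> b})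
  (L : list I) (F : (I -> R) -> R) (g : R -> I -> R) (t0 : R) (d : I -> R) :
  NoDup L -> depends_only (fun v => In v L) F -> of_class_C dec 1 F ->
  (forall v, In v L -> is_derive (fun t => g t v) t0 (d v)) ->
  is_derive (fun t => F (g t)) t0 (sum_over L (fun v => d v * partial dec v F (g t0))).
Proof.
intros HL HF HC Hg; apply (chain_rule_aux dec L); auto.
- intros v; apply HC.
- intros v; apply (of_class_C_continuous dec 0); apply HC.
- intros v t H1 H2; contradiction.
Qed.

Lemma of_class_C_const {I : Type} (dec : forall a b : I, {a = b} + {a <> b}) n :
  forall c, of_class_C dec n (fun _ => c).
Proof.
induction n as [|n IH]; intros c; split; auto; try (intros; apply continuous_const).
intros v; split; [intros; apply ex_derive_const|].
replace (partial dec v (fun _ => c)) with (fun _ : I -> R => 0); [apply IH|].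
apply functional_extensionality; intros z; symmetry; exact (Derive_const c (z v)).
Qed.

Lemma partial_coord {I : Type} (dec : forall a b : I, {a = b} + {a <> b}) v w (z : I -> R) :
  is_derive (fun s => upd dec z v s w) (z v) (if dec w v then 1 else 0).
Proof.
unfold upd; destruct (dec w v); [apply @is_derive_id | apply @is_derive_const].
Qed.

Lemma of_class_C_coord {I : Type} (dec : forall a b : I, {a = b} + {a <> b}) n w :
  of_class_C dec n (fun z => z w).
Proof.
assert (Hc : forall z : I -> R, continuous (fun z : I -> R => z w) z).
{ intros z; apply filterlim_locally; intros eps; exists eps; intros y Hy; apply Hy. }
destruct n as [|n]; split; auto.
intros v; split; [intros z; eexists; apply partial_coord|].
replace (partial dec v (fun z => z w)) with (fun _ : I -> R => if dec w v then 1 else 0);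
  [apply of_class_C_const|].
apply functional_extensionality; intros z; symmetry.
apply is_derive_unique, partial_coord.
Qed.

Lemma of_class_C_plus {I : Type} (dec : forall a b : I, {a = b} + {a <> b}) n :
  forall F G, of_class_C dec n F -> of_class_C dec n G ->
  of_class_C dec n (fun z => F z + G z).
Proof.
induction n as [|n IH]; intros F G [HF HF'] [HG HG']; split; auto;
  try (intros z; now apply @continuous_plus).
intros v; destruct (HF' v) as [DF CF], (HG' v) as [DG CG]; split.
- intros z; apply @ex_derive_plus; auto.
- replace (partial dec v (fun z => F z + G z))
    with (fun z => partial dec v F z + partial dec v G z); [auto|].
  apply functional_extensionality; intros z; symmetry; unfold partial.
  rewrite Derive_plus; auto.
Qed.

Lemma of_class_C_mult {I : Type} (dec : forall a b : I, {a = b} + {a <> b}) n :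
  forall F G, of_class_C dec n F -> of_class_C dec n G ->
  of_class_C dec n (fun z => F z * G z).
Proof.
induction n as [|n IH]; intros F G HF0 HG0.
- split; auto; intros z; apply @continuous_mult; [apply HF0|apply HG0].
- assert (HF1 := of_class_C_pred dec n F HF0).
  assert (HG1 := of_class_C_pred dec n G HG0).
  destruct HF0 as [HF HF'], HG0 as [HG HG']; split;
    [intros z; now apply @continuous_mult|].
  intros v; destruct (HF' v) as [DF CF], (HG' v) as [DG CG]; split.
  + intros z; apply ex_derive_mult; auto.
  + replace (partial dec v (fun z => F z * G z))
      with (fun z => partial dec v F z * G z + F z * partial dec v G z).
    { apply of_class_C_plus; apply IH; auto. }
    apply functional_extensionality; intros z; symmetry; unfold partial.
    rewrite Derive_mult, upd_same; auto.
Qed.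

Lemma of_class_C_exp {I : Type} (dec : forall a b : I, {a = b} + {a <> b}) n :
  forall F, of_class_C dec n F -> of_class_C dec n (fun z => exp (F z)).
Proof.
assert (HE : forall F z, continuous F z -> continuous (fun z : I -> R => exp (F z)) z).
{ intros F z H; apply (continuous_comp F exp); auto; apply continuous_exp. }
induction n as [|n IH]; intros F HF; split; auto; try (intros z; apply HE, HF).
assert (HF1 := of_class_C_pred dec n F HF).
destruct HF as [HF HF']; intros v; destruct (HF' v) as [DF CF].
assert (D : forall z, is_derive (fun s => exp (F (upd dec z v s))) (z v)
                   (partial dec v F z * exp (F z))).
{ intros z.
  assert (E : exp (F z) = exp (F (upd dec z v (z v)))) by now rewrite upd_same.
  rewrite E.
  apply (is_derive_comp exp (fun s => F (upd dec z v s)));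
    [apply is_derive_exp | apply Derive_correct, DF]. }
split; [intros z; eexists; apply D|].
replace (partial dec v (fun z => exp (F z)))
  with (fun z => partial dec v F z * exp (F z)).
{ apply of_class_C_mult; auto. }
apply functional_extensionality; intros z; symmetry; apply is_derive_unique, D.
Qed.

Lemma of_class_C_sum_over {I J : Type} (dec : forall a b : I, {a = b} + {a <> b}) n
  (l : list J) (f : J -> (I -> R) -> R) :
  (forall j, In j l -> of_class_C dec n (f j)) ->
  of_class_C dec n (fun z => sum_over l (fun j => f j z)).
Proof.
induction l as [|j l IH]; intros H; simpl; [apply of_class_C_const|].
apply of_class_C_plus; [apply H; now left | apply IH; intros; apply H; now right].
Qed.

(** By the chain rule a partial derivative of the composite is a sum of products of partials of
    [g j] with composites of partials of [F]. The induction therefore runs over all [F] with support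
    in [L], a property that partials inherit. *)
Lemma of_class_C_comp {I J : Type} (decI : forall a b : I, {a = b} + {a <> b})
  (decJ : forall a b : J, {a = b} + {a <> b}) (L : list J) (HL : NoDup L)
  (g : J -> (I -> R) -> R) n :
  (forall j, of_class_C decI n (g j)) ->
  forall F, depends_only (fun j => In j L) F -> of_class_C decJ n F ->
  of_class_C decI n (fun z => F (fun j => g j z)).
Proof.
induction n as [|n IH]; intros Hg F HF CF.
- split; auto; intros z.
  apply (continuous_comp_finite decJ L F (fun z j => g j z)); auto; [apply CF|].
  intros; apply Hg.
- split.
  { intros z; apply (continuous_comp_finite decJ L F (fun z j => g j z)); auto; [apply CF|].
    intros; apply Hg. }
  intros v.
  assert (D : forall z, is_derive (fun s => F (fun j => g j (upd decI z v s))) (z v)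
     (sum_over L (fun j => partial decI v (g j) z * partial decJ j F (fun j => g j z)))).
  { intros z.
    assert (E : (fun j => g j z) = (fun j => g j (upd decI z v (z v))))
      by now rewrite upd_same.
    rewrite E.
    apply (chain_rule decJ L F (fun s j => g j (upd decI z v s))
             (z v) (fun j => partial decI v (g j) z)); auto.
    - apply (of_class_C_le decJ 1 (S n)); auto; lia.
    - intros j _; apply Derive_correct, (Hg j). }
  split; [intros z; eexists; apply D|].
  replace (partial decI v (fun z => F (fun j => g j z)))
    with (fun z => sum_over L (fun j => partial decI v (g j) z * partial decJ j F (fun j => g j z))).
  + apply (of_class_C_sum_over decI n L
      (fun j z => partial decI v (g j) z * partial decJ j F (fun j => g j z))).
    intros j _; apply of_class_C_mult; [apply (Hg j)|].
    apply IH; [intros; apply of_class_C_pred, Hg | now apply depends_only_partial | apply CF].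
  + apply functional_extensionality; intros z; symmetry; apply is_derive_unique, D.
Qed.

(** * Total derivatives along solutions *)

(** The enumeration follows the order of summation in [jet_sum], so that the two sums can be
    compared term by term. *)
Definition derivative_vars (n : nat) : list jetvar :=
  flat_map (fun m => flat_map (fun k =>
    [Jr r1 k (m - k); Jr r2 k (m - k); Jr r3 k (m - k)]) (seq 0 (S m))) (seq 0 (S n)).

Definition jet_vars (n : nat) : list jetvar := Jt :: Jx :: derivative_vars n.

Lemma in_derivative_vars n v :
  In v (derivative_vars n) <-> exists i k l, v = Jr i k l /\ (k + l <= n)%nat.
Proof.
unfold derivative_vars; rewrite in_flat_map; split.
- intros [m [Hm H]]; rewrite in_flat_map in H; destruct H as [k [Hk H]].
  rewrite in_seq in Hm, Hk.
  destruct H as [<-|[<-|[<-|[]]]]; do 3 eexists; (split; [reflexivity|]); lia.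
- intros [i [k [l [-> H]]]]; exists (k + l)%nat; rewrite in_seq; split; [lia|].
  rewrite in_flat_map; exists k; rewrite in_seq; split; [lia|].
  replace (k + l - k)%nat with l by lia; destruct i; simpl; auto.
Qed.

Lemma in_jet_vars n v : In v (jet_vars n) <-> jet_le n v.
Proof.
change (Jt = v \/ Jx = v \/ In v (derivative_vars n) <-> jet_le n v).
rewrite in_derivative_vars.
split.
- intros [<-|[<-|[i [k [l [-> H]]]]]]; simpl; auto.
- destruct v as [| |i k l]; simpl; auto.
  intros H; right; right; exists i, k, l; auto.
Qed.

Lemma NoDup_jet_vars n : NoDup (jet_vars n).
Proof.
unfold jet_vars.
constructor.
{ intros [H|H]; [discriminate|]; apply in_derivative_vars in H.
  destruct H as [i [k [l [H _]]]]; discriminate. }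
constructor.
{ intros H; apply in_derivative_vars in H.
  destruct H as [i [k [l [H _]]]]; discriminate. }
assert (Hin : forall m v, In v (flat_map (fun k =>
    [Jr r1 k (m - k); Jr r2 k (m - k); Jr r3 k (m - k)]) (seq 0 (S m))) ->
    exists i k l, v = Jr i k l /\ (k + l = m)%nat).
{ intros m v H; rewrite in_flat_map in H; destruct H as [k [Hk H]].
  rewrite in_seq in Hk.
  destruct H as [<-|[<-|[<-|[]]]]; do 3 eexists; (split; [reflexivity|]); lia. }
apply NoDup_flat_map_disjoint.
- apply seq_NoDup.
- intros m; apply NoDup_flat_map_disjoint.
  + apply seq_NoDup.
  + intros k; repeat constructor; simpl; intuition discriminate.
  + intros i j v H1 H2; simpl in H1, H2.
    destruct H1 as [<-|[<-|[<-|[]]]]; destruct H2 as [E|[E|[E|[]]]]; now injection E.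
- intros m m' v H1 H2; apply Hin in H1; apply Hin in H2.
  destruct H1 as [i [k [l [-> H1]]]], H2 as [i' [k' [l' [E H2]]]].
  injection E; intros; subst; reflexivity.
Qed.

Lemma Series_finite (a : nat -> R) (n : nat) :
  (forall m, (n < m)%nat -> a m = 0) -> Series a = sum_n a n.
Proof.
intros H; apply is_series_unique.
apply (filterlim_ext_loc (fun _ => sum_n a n)); [|apply filterlim_const].
exists n; intros m Hm; induction Hm as [|m Hm IH]; [reflexivity|].
rewrite sum_Sn, <- IH, H by lia; symmetry; apply Rplus_0_r.
Qed.

Lemma jet_sum_finite (a : unknown -> nat -> nat -> R) (n : nat) :
  (forall i k l, (n < k + l)%nat -> a i k l = 0) ->
  jet_sum a = sum_over (derivative_vars n)
    (fun v => match v with Jr i k l => a i k l | _ => 0 end).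
Proof.
intros H; unfold jet_sum, derivative_vars.
rewrite (Series_finite _ n).
- rewrite sum_over_flat_map, sum_over_seq; apply sum_n_ext; intros m.
  rewrite sum_over_flat_map, sum_over_seq; apply sum_n_ext; intros k; simpl.
  match goal with |- ?x = ?y => change (@eq R x y) end; ring.
- intros m Hm; rewrite (sum_n_ext_loc _ (fun _ => 0)).
  + rewrite sum_n_const; apply Rmult_0_r.
  + intros k Hk; rewrite !H by lia; rewrite !Rplus_0_r; reflexivity.
Qed.

(* [b = true] stands for x and [b = false] for t, here and in [jet_dir]. *)
Definition total (b : bool) (F : jet -> R) : jet -> R :=
  if b then total_Dx F else total_Dt F.

Definition jet_dir (b : bool) (v : jetvar) (z : jet) : R :=
  match v with
  | Jt => if b then 0 else 1
  | Jx => if b then 1 else 0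
  | Jr i k l => if b then z (Jr i k (S l)) else z (Jr i (S k) l)
  end.

Notation jpartial := (partial jetvar_eq_dec).

Lemma order_le_in n F : order_le n F -> depends_only (fun v => In v (jet_vars n)) F.
Proof. apply depends_only_weaken; intros v; apply in_jet_vars. Qed.

(** Partials in variables beyond the order vanish, which turns the series into the finite sum
    produced by [chain_rule]. *)
Lemma total_sum_over b n F : order_le n F ->
  total b F = fun z => sum_over (jet_vars n) (fun v => jet_dir b v z * jpartial v F z).
Proof.
intros HF; apply functional_extensionality; intros z.
assert (H : forall i k l, (n < k + l)%nat -> jpartial (Jr i k l) F z = 0).
{ intros i k l H; apply (partial_off_support _ _ _ _ HF); simpl; lia. }
destruct b; unfold total, total_Dt, total_Dx;
  (rewrite (jet_sum_finite _ n); [|intros i k l Hkl; rewrite H by auto; ring]);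
  unfold jet_vars; rewrite !sum_over_cons.
- rewrite (sum_over_ext (derivative_vars n) _ (fun v => jet_dir true v z * jpartial v F z)).
  + simpl; ring.
  + intros v Hv; apply in_derivative_vars in Hv; destruct Hv as [i [k [l [-> _]]]].
    reflexivity.
- rewrite (sum_over_ext (derivative_vars n) _ (fun v => jet_dir false v z * jpartial v F z)).
  + simpl; ring.
  + intros v Hv; apply in_derivative_vars in Hv; destruct Hv as [i [k [l [-> _]]]].
    reflexivity.
Qed.

Lemma smooth_jet_dir b v : smooth jetvar_eq_dec (jet_dir b v).
Proof.
intros n; destruct v as [| |i k l], b;
  first [exact (of_class_C_const jetvar_eq_dec n 0)
        | exact (of_class_C_const jetvar_eq_dec n 1)
        | exact (of_class_C_coord jetvar_eq_dec n (Jr i k (S l)))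
        | exact (of_class_C_coord jetvar_eq_dec n (Jr i (S k) l))].
Qed.

Lemma smooth_total b n F : smooth jetvar_eq_dec F -> order_le n F ->
  smooth jetvar_eq_dec (total b F).
Proof.
intros HF Hn m; rewrite (total_sum_over b n F Hn).
apply (of_class_C_sum_over _ _ _ (fun v z => jet_dir b v z * jpartial v F z)).
intros v _; apply of_class_C_mult; [apply smooth_jet_dir | now apply smooth_partial].
Qed.

Lemma order_le_total b n F : order_le n F -> order_le (S n) (total b F).
Proof.
intros Hn; rewrite (total_sum_over b n F Hn); intros z w E.
apply sum_over_ext; intros v Hv; apply in_jet_vars in Hv.
f_equal.
- destruct v as [| |i k l], b; simpl in *; auto; apply E; simpl; lia.
- apply (depends_only_partial _ _ v F Hn); intros y Hy; apply E.
  destruct y; simpl in *; auto.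
Qed.

Lemma diff_function_total b F : diff_function F -> diff_function (total b F).
Proof.
intros [HF [n Hn]]; split; [now apply (smooth_total b n)|].
exists (S n); now apply order_le_total.
Qed.

(** Regularity of a solution without the equations: the deformations used against null divergences
    leave the solution set. *)
Definition smooth_on (U : R * R -> Prop) (u : unknown -> R -> R -> R) : Prop :=
  open U /\ forall i t x, U (t, x) -> forall n, ex_diff_n (u i) n t x.

Lemma open_locally_2d (U : R * R -> Prop) t x :
  open U -> U (t, x) -> locally_2d (fun t x => U (t, x)) t x.
Proof.
intros HU H; apply locally_2d_locally.
generalize (HU _ H); apply filter_imp; now intros [a b].
Qed.

Lemma is_derive_prolong (b : bool) U u t x v : smooth_on U u -> U (t, x) ->
  is_derive (fun s => prolong u (if b then t else s) (if b then s else x) v)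
    (if b then x else t) (jet_dir b v (prolong u t x)).
Proof.
intros [HU Hu] H; destruct v as [| |i k l]; simpl.
- destruct b; [apply @is_derive_const | apply @is_derive_id].
- destruct b; [apply @is_derive_id | apply @is_derive_const].
- destruct b.
  (* In [partial_derive] the x-derivatives are taken first, so one more t-derivative is outermost by
     definition, whereas one more x-derivative has to be moved past the t-derivatives. This exchange
     uses smoothness on a neighbourhood, hence the openness of [U]. *)
  + rewrite <- Derive_partial_derive.
    * apply Derive_correct.
      apply (ex_diff_n_ex_deriv_inf_2 (S (k + l))); [lia | now apply Hu].
    * generalize (open_locally_2d U t x HU H).
      intros [d Hd]; exists d; intros; apply Hu; auto.
  + unfold partial_derive at 2; simpl.
    apply (Derive_correct (fun s => partial_derive k l (u i) s x)).
    apply (ex_diff_n_ex_deriv_inf_1 (S (k + l))); [lia | now apply Hu].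
Qed.

Lemma continuous_prolong U u t x v : smooth_on U u -> U (t, x) ->
  continuous (fun p : R * R => prolong u (fst p) (snd p) v) (t, x).
Proof.
intros [HU Hu] H; destruct v as [| |i k l].
- apply continuous_fst.
- apply continuous_snd.
- apply (continuity_2d_pt_filterlim (partial_derive k l (u i))).
  generalize (ex_diff_n_deriv (k + l) k l (le_n _) (u i) t x (Hu i t x H _)).
  rewrite Nat.sub_diag; intros E; apply E.
Qed.

Lemma continuous_along U u F t x : smooth_on U u -> U (t, x) -> diff_function F ->
  continuity_2d_pt (fun t x => F (prolong u t x)) t x.
Proof.
intros Hu H [HF [n Hn]]; apply continuity_2d_pt_filterlim.
apply (continuous_comp_finite jetvar_eq_dec (jet_vars n) F
         (fun p : R * R => prolong u (fst p) (snd p)) (t, x)).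
- now apply order_le_in.
- apply (HF 0%nat).
- intros v _; now apply (continuous_prolong U).
Qed.

Lemma is_derive_along (b : bool) U u F t x : smooth_on U u -> U (t, x) -> diff_function F ->
  is_derive (fun s => F (prolong u (if b then t else s) (if b then s else x)))
    (if b then x else t) (total b F (prolong u t x)).
Proof.
intros Hu H [HF [n Hn]]; rewrite (total_sum_over b n F Hn).
assert (E : prolong u t x =
  prolong u (if b then t else if b then x else t) (if b then if b then x else t else x))
  by now destruct b.
rewrite (sum_over_ext _ _ (fun v => jet_dir b v (prolong u t x) *
  jpartial v F (prolong u (if b then t else if b then x else t)
                          (if b then if b then x else t else x)))).
- apply (chain_rule jetvar_eq_dec (jet_vars n) F
    (fun s => prolong u (if b then t else s) (if b then s else x))).
  + apply NoDup_jet_vars.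
  + now apply order_le_in.
  + apply HF.
  + intros v _; now apply (is_derive_prolong b U).
- intros v _; now rewrite <- E.
Qed.

Lemma is_derive_along_t U u F t x : smooth_on U u -> U (t, x) -> diff_function F ->
  is_derive (fun s => F (prolong u s x)) t (total_Dt F (prolong u t x)).
Proof. exact (is_derive_along false U u F t x). Qed.

Lemma is_derive_along_x U u F t x : smooth_on U u -> U (t, x) -> diff_function F ->
  is_derive (fun s => F (prolong u t s)) x (total_Dx F (prolong u t x)).
Proof. exact (is_derive_along true U u F t x). Qed.

Lemma diff_function_Dt F : diff_function F -> diff_function (total_Dt F).
Proof. exact (diff_function_total false F). Qed.

Lemma diff_function_Dx F : diff_function F -> diff_function (total_Dx F).
Proof. exact (diff_function_total true F). Qed.

(** Evaluation along [u] reduces the claim to Schwarz's theorem for the function [f] of (t,x), with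
    no manipulation of the jet sums. *)
Lemma total_derivatives_commute U u F t x :
  smooth_on U u -> U (t, x) -> diff_function F ->
  total_Dt (total_Dx F) (prolong u t x) = total_Dx (total_Dt F) (prolong u t x).
Proof.
intros Hu H HF.
set (f := fun t x => F (prolong u t x)).
assert (Hloc : forall t x, U (t, x) -> locally_2d (fun t x => U (t, x)) t x)
  by (intros; apply open_locally_2d; auto; apply Hu).
assert (HD := diff_function_Dt F HF); assert (HX := diff_function_Dx F HF).
assert (Dtx : forall a b, U (a, b) ->
  is_derive (fun z => Derive (fun s => f z s) b) a (total_Dt (total_Dx F) (prolong u a b))).
{ intros a b Hab.
  apply (is_derive_ext_loc (fun z => total_Dx F (prolong u z b))).
  - generalize (locally_2d_1d_const_y _ _ _ (Hloc a b Hab)); apply filter_imp.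
    intros z Hz; symmetry; apply is_derive_unique; now apply (is_derive_along_x U).
  - now apply (is_derive_along_t U). }
assert (Dxt : forall a b, U (a, b) ->
  is_derive (fun z => Derive (fun s => f s z) a) b (total_Dx (total_Dt F) (prolong u a b))).
{ intros a b Hab.
  apply (is_derive_ext_loc (fun z => total_Dt F (prolong u a z))).
  - generalize (locally_2d_1d_const_x _ _ _ (Hloc a b Hab)); apply filter_imp.
    intros z Hz; symmetry; apply is_derive_unique; now apply (is_derive_along_t U).
  - now apply (is_derive_along_x U). }
rewrite <- (is_derive_unique _ _ _ (Dtx t x H)), <- (is_derive_unique _ _ _ (Dxt t x H)).
apply (Schwarz f).
- destruct (Hloc t x H) as [d Hd]; exists d; intros a b Ha Hb.
  specialize (Hd a b Ha Hb); simpl in Hd; repeat split.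
  + eexists; now apply (is_derive_along_t U).
  + eexists; now apply (is_derive_along_x U).
  + eexists; now apply Dtx.
  + eexists; now apply Dxt.
- apply (continuity_2d_pt_ext_loc (fun a b => total_Dt (total_Dx F) (prolong u a b))).
  + destruct (Hloc t x H) as [d Hd]; exists d; intros a b Ha Hb.
    symmetry; apply is_derive_unique, Dtx; now apply Hd.
  + apply (continuous_along U); auto; now apply diff_function_Dt.
- apply (continuity_2d_pt_ext_loc (fun a b => total_Dx (total_Dt F) (prolong u a b))).
  + destruct (Hloc t x H) as [d Hd]; exists d; intros a b Ha Hb.
    symmetry; apply is_derive_unique, Dxt; now apply Hd.
  + apply (continuous_along U); auto; now apply diff_function_Dx.
Qed.

(** * Conservation *)

Lemma order_le_weaken n m F : (n <= m)%nat -> order_le n F -> order_le m F.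
Proof.
intros H; apply depends_only_weaken; intros [| |i k l]; simpl; auto; lia.
Qed.

Lemma order_le_binop (op : R -> R -> R) n F G :
  order_le n F -> order_le n G -> order_le n (fun z => op (F z) (G z)).
Proof. intros HF HG z w E; now rewrite (HF z w E), (HG z w E). Qed.

Lemma diff_function_mult F G :
  diff_function F -> diff_function G -> diff_function (fun z => F z * G z).
Proof.
intros [HF [n Hn]] [HG [m Hm]]; split.
- intros k; apply of_class_C_mult; auto.
- exists (n + m)%nat; apply order_le_binop;
    [apply (order_le_weaken n) | apply (order_le_weaken m)]; auto; lia.
Qed.

Lemma diff_function_plus F G :
  diff_function F -> diff_function G -> diff_function (fun z => F z + G z).
Proof.
intros [HF [n Hn]] [HG [m Hm]]; split.
- intros k; apply of_class_C_plus; auto.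
- exists (n + m)%nat; apply order_le_binop;
    [apply (order_le_weaken n) | apply (order_le_weaken m)]; auto; lia.
Qed.

Lemma diff_function_const c : diff_function (fun _ => c).
Proof. split; [intros n; apply of_class_C_const | exists 0%nat; intros z w _; reflexivity]. Qed.

Lemma diff_function_coord i k l : diff_function (fun z => z (Jr i k l)).
Proof.
split; [intros n; apply of_class_C_coord|].
exists (k + l)%nat; intros z w E; apply E; simpl; lia.
Qed.

Lemma diff_function_minus F G :
  diff_function F -> diff_function G -> diff_function (fun z => F z - G z).
Proof.
intros HF HG.
replace (fun z => F z - G z) with (fun z => F z + (-1) * G z)
  by (apply functional_extensionality; intros z; ring).
apply diff_function_plus; auto; apply diff_function_mult; auto; apply diff_function_const.
Qed.

Lemma diff_function_exp F : diff_function F -> diff_function (fun z => exp (F z)).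
Proof.
intros [HF [n Hn]]; split; [intros k; now apply of_class_C_exp|].
exists n; intros z w E; now rewrite (Hn z w E).
Qed.

Lemma smooth_order_omega j : smooth jetvar_eq_dec (omega j) /\ order_le j (omega j).
Proof.
induction j as [|j [IHs IHo]]; simpl.
- split; [intros n; apply of_class_C_coord | intros z w E; apply E; simpl; lia].
- split.
  + intros n; apply of_class_C_mult; [|apply (smooth_total true j); auto].
    apply (proj1 (diff_function_exp _ (diff_function_minus _ _
      (diff_function_coord r2 0 0) (diff_function_coord r1 0 0)))).
  + apply (order_le_binop Rmult); [|now apply (order_le_total true)].
    intros z w E; rewrite !E by (simpl; lia); reflexivity.
Qed.

Lemma diff_function_omega j : diff_function (omega j).
Proof. split; [|exists j]; apply smooth_order_omega. Qed.

Lemma depends_only_le_seq n (Om : (nat -> R) -> R) :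
  depends_only (fun j => (j <= n)%nat) Om ->
  depends_only (fun j => In j (seq 0 (S n))) Om.
Proof. apply depends_only_weaken; intros j Hj; apply in_seq; lia. Qed.

Lemma diff_function_Omega Om :
  admissible_Omega Om -> diff_function (fun z => Om (fun j => omega j z)).
Proof.
intros [HO [n Hn]]; split.
- intros k; apply (of_class_C_comp jetvar_eq_dec Nat.eq_dec (seq 0 (S n)) (seq_NoDup _ _) omega); auto.
  + intros j; apply smooth_order_omega.
  + now apply depends_only_le_seq.
- exists n; intros z w E; apply Hn; intros j Hj.
  apply (order_le_weaken j n); auto; apply smooth_order_omega.
Qed.

Lemma diff_current_C1 Om : admissible_Omega Om -> diff_current (current_C1 Om).
Proof.
intros HO; split; simpl.
- apply diff_function_mult; [|now apply diff_function_Omega].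
  apply diff_function_exp, diff_function_minus; apply diff_function_coord.
- apply diff_function_mult; [|now apply diff_function_Omega].
  apply diff_function_mult; [apply diff_function_plus; apply diff_function_coord|].
  apply diff_function_exp, diff_function_minus; apply diff_function_coord.
Qed.

Lemma is_derive_Rmult (f g : R -> R) x f' g' :
  is_derive f x f' -> is_derive g x g' ->
  is_derive (fun s => f s * g s) x (f' * g x + f x * g').
Proof. intros Hf Hg; apply (is_derive_mult f g); auto; intros; apply Rmult_comm. Qed.

Lemma is_derive_Rplus (f g : R -> R) x f' g' :
  is_derive f x f' -> is_derive g x g' -> is_derive (fun s => f s + g s) x (f' + g').
Proof. apply @is_derive_plus. Qed.

Lemma is_derive_Rminus (f g : R -> R) x f' g' :
  is_derive f x f' -> is_derive g x g' -> is_derive (fun s => f s - g s) x (f' - g').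
Proof. apply @is_derive_minus. Qed.

Lemma is_derive_exp_comp (f : R -> R) x f' :
  is_derive f x f' -> is_derive (fun s => exp (f s)) x (f' * exp (f x)).
Proof. intros Hf; apply (is_derive_comp exp f); auto; apply is_derive_exp. Qed.

Lemma is_solution_smooth_on U u : is_solution U u -> smooth_on U u.
Proof. intros [HU [Hu _]]; now split. Qed.

(** Consequences of the system may be differentiated in x, because they hold on a whole
    neighbourhood in the open set [U]. *)
Lemma total_Dx_of_vanishing U u F t x : smooth_on U u -> U (t, x) -> diff_function F ->
  (forall t x, U (t, x) -> F (prolong u t x) = 0) -> total_Dx F (prolong u t x) = 0.
Proof.
intros Hu H HF H0.
rewrite <- (is_derive_unique _ _ _ (is_derive_along_x U u F t x Hu H HF)).
rewrite (Derive_ext_loc _ (fun _ => 0)), Derive_const; [reflexivity|].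
generalize (locally_2d_1d_const_x _ _ _ (open_locally_2d U t x (proj1 Hu) H)).
apply filter_imp; intros s; apply H0.
Qed.

(** Lets total derivatives of products and exponentials be computed with the one-variable rules
    along [u], instead of Leibniz rules on jet space. *)
Lemma total_Dt_along U u F t x d : smooth_on U u -> U (t, x) -> diff_function F ->
  is_derive (fun s => F (prolong u s x)) t d -> total_Dt F (prolong u t x) = d.
Proof.
intros Hu H HF Hd; rewrite <- (is_derive_unique _ _ _ Hd); symmetry.
now apply is_derive_unique, (is_derive_along_t U).
Qed.

Lemma total_Dx_along U u F t x d : smooth_on U u -> U (t, x) -> diff_function F ->
  is_derive (fun s => F (prolong u t s)) x d -> total_Dx F (prolong u t x) = d.
Proof.
intros Hu H HF Hd; rewrite <- (is_derive_unique _ _ _ Hd); symmetry.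
now apply is_derive_unique, (is_derive_along_x U).
Qed.

(* On solutions the operator e^(r2-r1) D_x commutes with D_t + (r1+r2) D_x, which
   annihilates r3. *)
Lemma omega_transported U u t x j : is_solution U u -> U (t, x) ->
  total_Dt (omega j) (prolong u t x) +
  (prolong u t x (Jr r1 0 0) + prolong u t x (Jr r2 0 0)) *
    total_Dx (omega j) (prolong u t x) = 0.
Proof.
intros Hsol; revert t x; assert (Hu := is_solution_smooth_on U u Hsol).
induction j as [|j IH]; intros t x H.
- rewrite (total_Dt_along U u (omega 0) t x _ Hu H (diff_function_omega 0)
             (is_derive_prolong false U u t x (Jr r3 0 0) Hu H)).
  rewrite (total_Dx_along U u (omega 0) t x _ Hu H (diff_function_omega 0)
             (is_derive_prolong true U u t x (Jr r3 0 0) Hu H)).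
  exact (proj2 (proj2 Hsol) r3 t x H).
- assert (Hj := diff_function_omega j).
  assert (HX := diff_function_Dx _ Hj); assert (HT := diff_function_Dt _ Hj).
  assert (Et := total_Dt_along U u (omega (S j)) t x _ Hu H (diff_function_omega (S j))
    (is_derive_Rmult _ _ _ _ _
      (is_derive_exp_comp _ _ _
        (is_derive_Rminus _ _ _ _ _
          (is_derive_prolong false U u t x (Jr r2 0 0) Hu H)
          (is_derive_prolong false U u t x (Jr r1 0 0) Hu H)))
      (is_derive_along_t U u _ t x Hu H HX))).
  assert (Ex := total_Dx_along U u (omega (S j)) t x _ Hu H (diff_function_omega (S j))
    (is_derive_Rmult _ _ _ _ _
      (is_derive_exp_comp _ _ _
        (is_derive_Rminus _ _ _ _ _
          (is_derive_prolong true U u t x (Jr r2 0 0) Hu H)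
          (is_derive_prolong true U u t x (Jr r1 0 0) Hu H)))
      (is_derive_along_x U u _ t x Hu H HX))).
  set (E := fun z : jet => total_Dt (omega j) z +
              (z (Jr r1 0 0) + z (Jr r2 0 0)) * total_Dx (omega j) z).
  assert (HE : diff_function E).
  { apply diff_function_plus; auto; apply diff_function_mult; auto.
    apply diff_function_plus; apply diff_function_coord. }
  (* The induction hypothesis is differentiated in x; it then expresses D_t D_x omega^j through
     x-derivatives, once the total derivatives are interchanged. *)
  assert (E0 := total_Dx_of_vanishing U u E t x Hu H HE IH).
  rewrite (total_Dx_along U u E t x _ Hu H HE
    (is_derive_Rplus _ _ _ _ _
      (is_derive_along_x U u _ t x Hu H HT)
      (is_derive_Rmult _ _ _ _ _
        (is_derive_Rplus _ _ _ _ _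
          (is_derive_prolong true U u t x (Jr r1 0 0) Hu H)
          (is_derive_prolong true U u t x (Jr r2 0 0) Hu H))
        (is_derive_along_x U u _ t x Hu H HX)))) in E0.
  rewrite <- (total_derivatives_commute U u (omega j) t x Hu H Hj) in E0.
  assert (S1 := proj2 (proj2 Hsol) r1 t x H).
  assert (S2 := proj2 (proj2 Hsol) r2 t x H).
  rewrite Et, Ex.
  unfold system, velocity in S1, S2; cbv beta; cbn [jet_dir] in *.
  set (z := prolong u t x) in *.
  (* Put c = r1 + r2. The velocities c + 1 and c - 1 give (D_t + c D_x)(r2 - r1) = r1_x + r2_x = D_x
     c, which cancels the term - D_x c D_x omega^j coming from the commutation with D_x. *)
  replace (z (Jr r1 1 0)) with (- (z (Jr r1 0 0) + z (Jr r2 0 0) + 1) * z (Jr r1 0 1)) by lra.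
  replace (z (Jr r2 1 0)) with (- (z (Jr r1 0 0) + z (Jr r2 0 0) - 1) * z (Jr r2 0 1)) by lra.
  replace (total_Dt (total_Dx (omega j)) z) with
    (- ((z (Jr r1 0 1) + z (Jr r2 0 1)) * total_Dx (omega j) z +
        (z (Jr r1 0 0) + z (Jr r2 0 0)) * total_Dx (total_Dx (omega j)) z)) by lra.
  ring.
Qed.

Lemma current_C1_conserved Om : admissible_Omega Om -> conserved_current (current_C1 Om).
Proof.
intros HO; assert (HC := diff_current_C1 Om HO); split; auto.
intros U u Hsol t x H.
assert (Hu := is_solution_smooth_on U u Hsol).
destruct HO as [HOs [n Hn]].
set (L := seq 0 (S n)).
assert (HL : depends_only (fun j => In j L) Om) by now apply depends_only_le_seq.
assert (Wt := chain_rule Nat.eq_dec L Om (fun s j => omega j (prolong u s x)) t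
  (fun j => total_Dt (omega j) (prolong u t x)) (seq_NoDup _ _) HL (HOs 1%nat)
  (fun j _ => is_derive_along_t U u _ t x Hu H (diff_function_omega j))).
assert (Wx := chain_rule Nat.eq_dec L Om (fun s j => omega j (prolong u t s)) x
  (fun j => total_Dx (omega j) (prolong u t x)) (seq_NoDup _ _) HL (HOs 1%nat)
  (fun j _ => is_derive_along_x U u _ t x Hu H (diff_function_omega j))).
cbv beta in Wt, Wx.
(* Each omega^j satisfies the transport equation with the same velocity, so the linear combinations
   given by the chain rule satisfy it too: Omega itself is transported. *)
assert (E : sum_over L (fun j => total_Dt (omega j) (prolong u t x) *
      partial Nat.eq_dec j Om (fun i => omega i (prolong u t x))) =
    - (prolong u t x (Jr r1 0 0) + prolong u t x (Jr r2 0 0)) *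
    sum_over L (fun j => total_Dx (omega j) (prolong u t x) *
      partial Nat.eq_dec j Om (fun i => omega i (prolong u t x)))).
{ clearbody L; clear - Hsol H; induction L as [|j L IH]; [simpl; ring|].
  rewrite !sum_over_cons, IH.
  assert (Hj := omega_transported U u t x j Hsol H).
  replace (total_Dt (omega j) (prolong u t x)) with
    (- (prolong u t x (Jr r1 0 0) + prolong u t x (Jr r2 0 0)) *
      total_Dx (omega j) (prolong u t x)) by lra.
  ring. }
rewrite E in Wt; clear E.
assert (E1 := total_Dt_along U u (fst (current_C1 Om)) t x _ Hu H (proj1 HC)
  (is_derive_Rmult _ _ _ _ _
    (is_derive_exp_comp _ _ _
      (is_derive_Rminus _ _ _ _ _
        (is_derive_prolong false U u t x (Jr r1 0 0) Hu H)
        (is_derive_prolong false U u t x (Jr r2 0 0) Hu H)))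
    Wt)).
assert (E2 := total_Dx_along U u (snd (current_C1 Om)) t x _ Hu H (proj2 HC)
  (is_derive_Rmult _ _ _ _ _
    (is_derive_Rmult _ _ _ _ _
      (is_derive_Rplus _ _ _ _ _
        (is_derive_prolong true U u t x (Jr r1 0 0) Hu H)
        (is_derive_prolong true U u t x (Jr r2 0 0) Hu H))
      (is_derive_exp_comp _ _ _
        (is_derive_Rminus _ _ _ _ _
          (is_derive_prolong true U u t x (Jr r1 0 0) Hu H)
          (is_derive_prolong true U u t x (Jr r2 0 0) Hu H))))
    Wx)).
unfold total_div; rewrite E1, E2; cbv beta; cbn [jet_dir].
assert (S1 := proj2 (proj2 Hsol) r1 t x H).
assert (S2 := proj2 (proj2 Hsol) r2 t x H).
unfold system, velocity in S1, S2.
set (z := prolong u t x) in *.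
(* With c = r1 + r2, the same computation yields (D_t + c D_x)(r1 - r2) = - D_x c, that is, D_t
   e^(r1-r2) + D_x (c e^(r1-r2)) = 0. *)
replace (z (Jr r1 1 0)) with (- (z (Jr r1 0 0) + z (Jr r2 0 0) + 1) * z (Jr r1 0 1)) by lra.
replace (z (Jr r2 1 0)) with (- (z (Jr r1 0 0) + z (Jr r2 0 0) - 1) * z (Jr r2 0 1)) by lra.
ring.
Qed.

(** * Smooth functions of one variable *)

(** Heine-Cantor along the compact curve p([a,b]), in the form where [w] may lie off the curve. It
    makes the choice of [d] independent of x. *)
Lemma uniform_finite_dep_continuous {I : Type}
  (dec : forall a b : I, {a = b} + {a <> b}) (l : list I) (F : (I -> R) -> R)
  (p : R -> I -> R) (a b : R) :
  depends_only (fun v => In v l) F -> (forall z, continuous F z) ->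
  (forall v x, In v l -> continuous (fun x => p x v) x) ->
  forall eps : posreal, exists d : posreal, forall x w, a <= x <= b ->
    (forall v, In v l -> Rabs (w v - p x v) < d) -> Rabs (F w - F (p x)) < eps.
Proof.
intros HF HC Hp eps.
assert (H : forall t, exists d : posreal, forall x w, Rabs (x - t) < d ->
  (forall v, In v l -> Rabs (w v - p x v) < d) -> Rabs (F w - F (p t)) < pos_div_2 eps).
{ intros t.
  destruct (finite_dep_continuous dec l F (p t) HF (HC (p t)) (pos_div_2 eps)) as [d Hd].
  destruct (locally_forall_list l (fun v x => Rabs (p x v - p t v) < pos_div_2 d) t) as [e He].
  { intros v Hv.
    exact (proj1 (filterlim_locally (fun y => p y v) (p t v)) (Hp v t Hv) (pos_div_2 d)). }
  (* Half of [d] is reserved for the distance from [w] to [p x], the other half for that from [p x]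
     to [p t]. *)
  assert (Hm : 0 < Rmin e (pos_div_2 d)) by (apply Rmin_pos; apply cond_pos).
  exists (mkposreal _ Hm); simpl; intros x w Hx Hw; apply Hd; intros v Hv.
  assert (H1 := He x (Rlt_le_trans _ _ _ Hx (Rmin_l _ _)) v Hv); simpl in H1.
  assert (H2 := Rlt_le_trans _ _ _ (Hw v Hv) (Rmin_r _ _)).
  replace (w v - p t v) with ((w v - p x v) + (p x v - p t v)) by ring.
  eapply Rle_lt_trans; [apply Rabs_triang|]; simpl in *; lra. }
set (delta := fun t => proj1_sig (constructive_indefinite_description _ (H t))).
assert (Hdelta : forall t x w, Rabs (x - t) < delta t ->
  (forall v, In v l -> Rabs (w v - p x v) < delta t) -> Rabs (F w - F (p t)) < pos_div_2 eps).
{ intros t; exact (proj2_sig (constructive_indefinite_description _ (H t))). }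
(* The radii [delta] form a gauge on [a,b]; compactness gives a uniform [d], but the covering point
   t only under a double negation, hence [NNPP]. *)
destruct (compactness_value_1d a b delta) as [d Hd].
exists d; intros x w Hx Hw; apply NNPP; intros Hn; apply (Hd x Hx).
intros [t [_ [Hxt Hdt]]]; apply Hn.
assert (H1 : Rabs (F w - F (p t)) < pos_div_2 eps).
{ apply (Hdelta t x); auto; intros v Hv; apply Rlt_le_trans with (2 := Hdt); auto. }
assert (H2 : Rabs (F (p x) - F (p t)) < pos_div_2 eps).
{ apply (Hdelta t x); auto; intros v Hv; unfold Rminus; rewrite Rplus_opp_r, Rabs_R0.
  apply cond_pos. }
replace (F w - F (p x)) with ((F w - F (p t)) - (F (p x) - F (p t))) by ring.
eapply Rle_lt_trans; [apply Rabs_triang|]; rewrite Rabs_Ropp; simpl in *; lra.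
Qed.

Fixpoint derivable_times (n : nat) (f : R -> R) : Prop :=
  match n with
  | O => True
  | S n => (forall x, ex_derive f x) /\ derivable_times n (Derive f)
  end.

Definition smooth1 (f : R -> R) : Prop := forall n, derivable_times n f.

Lemma smooth1_Derive f : smooth1 f -> smooth1 (Derive f).
Proof. intros H n; apply (H (S n)). Qed.

Lemma smooth1_ex_derive f x : smooth1 f -> ex_derive f x.
Proof. intros H; apply (H 1%nat). Qed.

Lemma Derive_n_Derive f n x : Derive_n (Derive f) n x = Derive_n f (S n) x.
Proof.
revert x; induction n as [|n IH]; intros x; [reflexivity|].
simpl; apply Derive_ext; intros t; apply IH.
Qed.

Lemma smooth1_ex_derive_n f n x : smooth1 f -> ex_derive (Derive_n f n) x.
Proof.
revert f; induction n as [|n IH]; intros f H; [now apply smooth1_ex_derive|].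
apply (ex_derive_ext (Derive_n (Derive f) n)); [intros; apply Derive_n_Derive|].
now apply IH, smooth1_Derive.
Qed.

Lemma derivable_times_pred n : forall f, derivable_times (S n) f -> derivable_times n f.
Proof. induction n as [|n IH]; intros f [H H']; split; auto. Qed.

Lemma derivable_times_plus n : forall f g, derivable_times n f -> derivable_times n g ->
  derivable_times n (fun x => f x + g x).
Proof.
induction n as [|n IH]; intros f g Hf Hg; [exact I|].
destruct Hf as [Df Hf], Hg as [Dg Hg]; split.
- intros x; now apply @ex_derive_plus.
- replace (Derive (fun x => f x + g x)) with (fun x => Derive f x + Derive g x); auto.
  apply functional_extensionality; intros x; now rewrite Derive_plus.
Qed.

Lemma derivable_times_mult n : forall f g, derivable_times n f -> derivable_times n g ->
  derivable_times n (fun x => f x * g x).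
Proof.
induction n as [|n IH]; intros f g Hf Hg; [exact I|].
assert (Hf' := derivable_times_pred n f Hf); assert (Hg' := derivable_times_pred n g Hg).
destruct Hf as [Df Hf], Hg as [Dg Hg]; split.
- intros x; now apply ex_derive_mult.
- replace (Derive (fun x => f x * g x)) with (fun x => Derive f x * g x + f x * Derive g x).
  + apply derivable_times_plus; auto.
  + apply functional_extensionality; intros x; now rewrite Derive_mult.
Qed.

Lemma smooth1_plus f g : smooth1 f -> smooth1 g -> smooth1 (fun x => f x + g x).
Proof. intros Hf Hg n; now apply derivable_times_plus. Qed.

Lemma smooth1_mult f g : smooth1 f -> smooth1 g -> smooth1 (fun x => f x * g x).
Proof. intros Hf Hg n; now apply derivable_times_mult. Qed.

Lemma smooth1_const c : smooth1 (fun _ => c).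
Proof.
intros n; revert c; induction n as [|n IH]; intros c; [exact I|].
split; [intros; apply ex_derive_const|].
replace (Derive (fun _ => c)) with (fun _ : R => 0); auto.
apply functional_extensionality; intros x; now rewrite Derive_const.
Qed.

Lemma smooth1_id : smooth1 (fun x => x).
Proof.
intros [|n]; [exact I|]; split; [intros; apply ex_derive_id|].
replace (Derive (fun x => x)) with (fun _ : R => 1); [apply smooth1_const|].
apply functional_extensionality; intros x; now rewrite Derive_id.
Qed.

Lemma smooth1_pow f n : smooth1 f -> smooth1 (fun x => f x ^ n).
Proof.
intros H; induction n as [|n IH]; simpl; [apply smooth1_const | now apply smooth1_mult].
Qed.

Lemma smooth1_one_minus f : smooth1 f -> smooth1 (fun x => 1 - f x).
Proof.
intros H.
replace (fun x => 1 - f x) with (fun x => 1 + (-1) * f x)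
  by (apply functional_extensionality; intros x; ring).
apply smooth1_plus; [apply smooth1_const|]; apply smooth1_mult; auto; apply smooth1_const.
Qed.

(** Writing the cosine as a shifted sine keeps derivatives in a single family, indexed by the phase,
    over which inductions can quantify. *)
Lemma is_derive_sin_affine nu c x :
  is_derive (fun x => sin (nu * x + c)) x (nu * sin (nu * x + (c + PI / 2))).
Proof.
replace (nu * x + (c + PI / 2)) with (PI / 2 + (nu * x + c)) by ring.
rewrite <- cos_sin; auto_derive; [auto | ring].
Qed.

Lemma smooth1_sin_affine nu c : smooth1 (fun x => sin (nu * x + c)).
Proof.
intros n; revert c; induction n as [|n IH]; intros c; [exact I|].
split; [intros x; eexists; apply is_derive_sin_affine|].
replace (Derive (fun x => sin (nu * x + c)))
  with (fun x => nu * sin (nu * x + (c + PI / 2))).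
- apply derivable_times_mult; [apply smooth1_const | apply IH].
- apply functional_extensionality; intros x; symmetry.
  apply is_derive_unique, is_derive_sin_affine.
Qed.

Lemma smooth1_continuous f x : smooth1 f -> continuous f x.
Proof. intros H; apply (ex_derive_continuous f), smooth1_ex_derive, H. Qed.

Lemma smooth1_Derive_n f n : smooth1 f -> smooth1 (Derive_n f n).
Proof.
revert f; induction n as [|n IH]; intros f H; auto.
replace (Derive_n f (S n)) with (Derive_n (Derive f) n).
- now apply IH, smooth1_Derive.
- apply functional_extensionality; intros x; apply Derive_n_Derive.
Qed.

Lemma is_derive_pow_mult g q n t : smooth1 g -> smooth1 q ->
  is_derive (fun t => g t ^ S n * q t) t
    (g t ^ n * (INR (S n) * Derive g t * q t + g t * Derive q t)).
Proof.
intros Hg Hq.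
assert (Dg := Derive_correct g t (smooth1_ex_derive g t Hg)).
assert (Dq := Derive_correct q t (smooth1_ex_derive q t Hq)).
assert (H := is_derive_Rmult _ _ _ _ _ (is_derive_pow g (S n) t _ Dg) Dq).
cbv beta in H; replace (g t ^ n * (INR (S n) * Derive g t * q t + g t * Derive q t))
  with (INR (S n) * Derive g t * g t ^ Init.Nat.pred (S n) * q t + g t ^ S n * Derive q t);
  [exact H | simpl pow; simpl Init.Nat.pred; ring].
Qed.

(** Differentiation lowers the exponent of g by one and leaves a smooth cofactor. The cofactor [q]
    is generalized to absorb everything else. *)
Lemma Derive_n_at_zero_of_pow g n k a : smooth1 g -> g a = 0 ->
  forall q, smooth1 q -> (k < n)%nat -> Derive_n (fun t => g t ^ n * q t) k a = 0.
Proof.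
intros Hg Ha; revert n; induction k as [|k IH]; intros n q Hq Hk.
- simpl; rewrite Ha, pow_i by lia; ring.
- destruct n as [|n]; [lia|].
  rewrite <- Derive_n_Derive.
  replace (Derive (fun t => g t ^ S n * q t))
    with (fun t => g t ^ n * (INR (S n) * Derive g t * q t + g t * Derive q t)).
  + apply (IH n (fun t => INR (S n) * Derive g t * q t + g t * Derive q t)); [|lia].
    apply smooth1_plus; repeat apply smooth1_mult; auto;
      try apply smooth1_const; now apply smooth1_Derive.
  + apply functional_extensionality; intros t; symmetry.
    apply is_derive_unique; now apply is_derive_pow_mult.
Qed.

(** The time profile of the deformation: up to order n it looks like 0 at time 0 and like the
    constant 1, hence static, at time 1. The polynomial (1 - (1-t)^(n+2))^(n+2) does this: its base
    vanishes at 0, and its derivative contains the factor (1-t)^(n+1). *)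
Lemma smooth_step (n : nat) : exists h, smooth1 h /\
  (forall k, (k <= n)%nat -> Derive_n h k 0 = 0) /\
  (forall k, (k <= n)%nat -> Derive_n h k 1 = Derive_n (fun _ => 1) k 1).
Proof.
set (g := fun t => 1 - (1 - t) ^ S (S n)).
assert (H1 : smooth1 (fun t => 1 - t)) by apply smooth1_one_minus, smooth1_id.
assert (Hg : smooth1 g) by apply smooth1_one_minus, smooth1_pow, H1.
exists (fun t => g t ^ S (S n) * 1); split; [|split].
- apply smooth1_mult; [now apply smooth1_pow | apply smooth1_const].
- intros k Hk; apply (Derive_n_at_zero_of_pow g (S (S n)) k 0 Hg);
    [|apply smooth1_const|lia].
  unfold g; rewrite Rminus_0_r, pow1; ring.
- intros [|k] Hk.
  + simpl Derive_n; unfold g.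
    replace (1 - 1) with 0 by ring; rewrite pow_i by lia.
    rewrite Rminus_0_r, pow1; ring.
  + rewrite Derive_n_const, <- Derive_n_Derive.
    set (q := fun t => INR (S (S n)) * INR (S (S n)) * g t ^ S n).
    assert (Hq : smooth1 q).
    { apply smooth1_mult; [apply smooth1_const | now apply smooth1_pow]. }
    replace (Derive (fun t => g t ^ S (S n) * 1)) with (fun t => (1 - t) ^ S n * q t).
    * apply (Derive_n_at_zero_of_pow (fun t => 1 - t) (S n) k 1 H1 (Rminus_diag_eq 1 1 eq_refl) q Hq); lia.
    * apply functional_extensionality; intros t; symmetry; apply is_derive_unique.
      unfold q, g; auto_derive; [auto|].
      change (match n with 0%nat => 1 | S _ => INR n + 1 end) with (INR (S n)).
      rewrite !S_INR; simpl pow; unfold Rminus; ring.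
Qed.

(** The k-th derivative of phi(x) sin(nu x + c): each derivative either falls on phi or shifts the
    phase and yields a factor nu, so the powers of nu can be read off. *)
Fixpoint osc (k : nat) (phi : R -> R) (nu c x : R) : R :=
  match k with
  | O => phi x * sin (nu * x + c)
  | S k => osc k (Derive phi) nu c x + nu * osc k phi nu (c + PI / 2) x
  end.

Lemma is_derive_osc k : forall phi nu c x, smooth1 phi ->
  is_derive (osc k phi nu c) x (osc (S k) phi nu c x).
Proof.
induction k as [|k IH]; intros phi nu c x H.
- apply (is_derive_ext (fun x => phi x * sin (nu * x + c))); [reflexivity|].
  replace (osc 1 phi nu c x) with
    (Derive phi x * sin (nu * x + c) + phi x * (nu * sin (nu * x + (c + PI / 2))))
    by (simpl; ring).
  apply (is_derive_Rmult phi (fun x => sin (nu * x + c))); [now apply Derive_correct, smooth1_ex_derive|].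
  apply is_derive_sin_affine.
- apply (is_derive_Rplus (osc k (Derive phi) nu c) (fun x => nu * osc k phi nu (c + PI / 2) x)).
  + apply IH; now apply smooth1_Derive.
  + apply (is_derive_scal (osc k phi nu (c + PI / 2))); now apply IH.
Qed.

Lemma Derive_n_osc phi nu c k x : smooth1 phi ->
  Derive_n (fun x => phi x * sin (nu * x + c)) k x = osc k phi nu c x.
Proof.
intros H; revert x; induction k as [|k IH]; intros x; [reflexivity|].
simpl Derive_n; rewrite (Derive_ext _ (osc k phi nu c)) by apply IH.
now apply is_derive_unique, is_derive_osc.
Qed.

Lemma smooth1_bounded phi : smooth1 phi ->
  exists B, 0 <= B /\ forall x, 0 <= x <= 1 -> Rabs (phi x) <= B.
Proof.
intros H.
destruct (continuity_ab_maj (fun x => Rabs (phi x)) 0 1 Rle_0_1) as [m [Hm _]].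
- intros x _; apply (continuity_pt_comp phi Rabs); [|apply Rcontinuity_abs].
  apply continuity_pt_filterlim, smooth1_continuous, H.
- exists (Rabs (phi m)); split; [apply Rabs_pos | exact Hm].
Qed.

(** Uniformity in [c] is what lets the induction pass through the phase shift in [osc]. *)
Lemma osc_bound k : forall phi, smooth1 phi -> exists B, 0 <= B /\
  forall nu c x, 1 <= nu -> 0 <= x <= 1 -> Rabs (osc k phi nu c x) <= B * nu ^ k.
Proof.
induction k as [|k IH]; intros phi H.
- destruct (smooth1_bounded phi H) as [B [HB Hphi]]; exists B; split; auto.
  intros nu c x Hnu Hx; simpl; rewrite Rabs_mult.
  apply Rmult_le_compat; auto; try apply Rabs_pos.
  apply Rabs_le, SIN_bound.
- destruct (IH _ (smooth1_Derive phi H)) as [B1 [HB1 H1]].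
  destruct (IH _ H) as [B2 [HB2 H2]].
  exists (B1 + B2); split; [lra|]; intros nu c x Hnu Hx; simpl osc.
  eapply Rle_trans; [apply Rabs_triang|].
  rewrite Rabs_mult, (Rabs_pos_eq nu) by lra.
  specialize (H1 nu c x Hnu Hx); specialize (H2 nu (c + PI / 2) x Hnu Hx).
  assert (Hp : 0 < nu ^ k) by (apply pow_lt; lra).
  assert (nu * Rabs (osc k phi nu (c + PI / 2) x) <= nu * (B2 * nu ^ k))
    by (apply Rmult_le_compat_l; lra).
  assert (B1 * nu ^ k <= B1 * (nu * nu ^ k)).
  { apply Rmult_le_compat_l; auto; nra. }
  simpl pow; lra.
Qed.

Lemma osc_bound_upto m phi : smooth1 phi -> exists B, 0 <= B /\
  forall nu c x k, 1 <= nu -> 0 <= x <= 1 -> (k <= m)%nat ->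
  Rabs (osc k phi nu c x) <= B * nu ^ m.
Proof.
intros H; induction m as [|m [B1 [HB1 H1]]].
- destruct (osc_bound 0 phi H) as [B [HB H0]]; exists B; split; auto.
  intros nu c x k Hnu Hx Hk; replace k with 0%nat by lia; auto.
- destruct (osc_bound (S m) phi H) as [B [HB H0]]; exists (B + B1); split; [lra|].
  intros nu c x k Hnu Hx Hk.
  assert (Hp : 0 < nu ^ m) by (apply pow_lt; lra).
  assert (Hp' : nu ^ m <= nu ^ S m) by (simpl; nra).
  destruct (Nat.eq_dec k (S m)) as [->|Hne].
  + specialize (H0 nu c x Hnu Hx).
    assert (0 <= B1 * nu ^ S m) by (apply Rmult_le_pos; lra).
    lra.
  + specialize (H1 nu c x k Hnu Hx ltac:(lia)).
    assert (B1 * nu ^ m <= B1 * nu ^ S m) by (apply Rmult_le_compat_l; lra).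
    assert (0 <= B * nu ^ S m) by (apply Rmult_le_pos; lra).
    lra.
Qed.

(** Only the branch in which every derivative falls on the sine carries nu^(k+1); all others contain
    at least one derivative of phi and at most nu^k. *)
Lemma osc_leading k phi : smooth1 phi -> exists B, 0 <= B /\
  forall nu c x, 1 <= nu -> 0 <= x <= 1 ->
  Rabs (osc (S k) phi nu c x - nu ^ S k * (phi x * sin (nu * x + c + INR (S k) * (PI / 2))))
    <= B * nu ^ k.
Proof.
intros H; induction k as [|k IH].
- destruct (smooth1_bounded _ (smooth1_Derive phi H)) as [B [HB Hphi]].
  exists B; split; auto; intros nu c x Hnu Hx.
  replace (nu * x + c + INR 1 * (PI / 2)) with (nu * x + (c + PI / 2)) by (simpl; ring).
  replace (osc 1 phi nu c x - nu ^ 1 * (phi x * sin (nu * x + (c + PI / 2))))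
    with (Derive phi x * sin (nu * x + c)) by (simpl; ring).
  rewrite Rabs_mult; simpl; apply Rmult_le_compat; auto; try apply Rabs_pos.
  apply Rabs_le, SIN_bound.
- destruct (osc_bound (S k) _ (smooth1_Derive phi H)) as [B1 [HB1 H1]].
  destruct IH as [B2 [HB2 H2]].
  exists (B1 + B2); split; [lra|]; intros nu c x Hnu Hx.
  specialize (H1 nu c x Hnu Hx); specialize (H2 nu (c + PI / 2) x Hnu Hx).
  replace (nu * x + c + INR (S (S k)) * (PI / 2))
    with (nu * x + (c + PI / 2) + INR (S k) * (PI / 2)) by (rewrite (S_INR (S k)); ring).
  set (y := phi x * sin (nu * x + (c + PI / 2) + INR (S k) * (PI / 2))) in *.
  replace (osc (S (S k)) phi nu c x - nu ^ S (S k) * y) with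
    (osc (S k) (Derive phi) nu c x +
     nu * (osc (S k) phi nu (c + PI / 2) x - nu ^ S k * y))
    by (change (osc (S (S k)) phi nu c x) with
         (osc (S k) (Derive phi) nu c x + nu * osc (S k) phi nu (c + PI / 2) x);
        simpl pow; ring).
  eapply Rle_trans; [apply Rabs_triang|].
  rewrite Rabs_mult, (Rabs_pos_eq nu) by lra.
  assert (nu * Rabs (osc (S k) phi nu (c + PI / 2) x - nu ^ S k * y) <= nu * (B2 * nu ^ k))
    by (apply Rmult_le_compat_l; lra).
  simpl pow in *; lra.
Qed.

(** * Null divergences on static solutions *)

Definition whole_plane : R * R -> Prop := fun _ => True.

(** With r1 = r2 = 0 the system reduces to h' f = 0: constant [h] gives the static solutions, other
    profiles give the off-shell paths joining them. *)
Definition separated (h f : R -> R) (i : unknown) (t x : R) : R :=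
  match i with r3 => h t * f x | _ => 0 end.

Lemma continuity_2d_pt_of_continuous_t (h : R -> R) t x :
  continuous h t -> continuity_2d_pt (fun t _ => h t) t x.
Proof.
intros H; apply continuity_2d_pt_filterlim.
apply (continuous_comp (fun p : R * R => fst p) h); [apply continuous_fst | exact H].
Qed.

Lemma continuity_2d_pt_of_continuous_x (f : R -> R) t x :
  continuous f x -> continuity_2d_pt (fun _ x => f x) t x.
Proof.
intros H; apply continuity_2d_pt_filterlim.
apply (continuous_comp (fun p : R * R => snd p) f); [apply continuous_snd | exact H].
Qed.

Lemma ex_diff_n_product n : forall h f t x, smooth1 h -> smooth1 f ->
  ex_diff_n (fun t x => h t * f x) n t x.
Proof.
induction n as [|n IH]; intros h f t x Hh Hf; (split; [|try exact I]).
1,2: apply continuity_2d_pt_mult;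
  [apply continuity_2d_pt_of_continuous_t | apply continuity_2d_pt_of_continuous_x];
  now apply smooth1_continuous.
assert (Dt : forall t x, is_derive (fun z => h z * f x) t (Derive h t * f x)).
{ intros a b; replace (Derive h a * f b) with (Derive h a * f b + h a * 0) by ring.
  apply (is_derive_Rmult h (fun _ => f b)); [|apply @is_derive_const].
  now apply Derive_correct, smooth1_ex_derive. }
assert (Dx : forall t x, is_derive (fun z => h t * f z) x (h t * Derive f x)).
{ intros a b; replace (h a * Derive f b) with (0 * f b + h a * Derive f b) by ring.
  apply (is_derive_Rmult (fun _ => h a) f); [apply @is_derive_const|].
  now apply Derive_correct, smooth1_ex_derive. }
split; [eexists; apply Dt|]; split; [eexists; apply Dx|]; split.
- replace (fun u v => Derive (fun z => h z * f v) u) with (fun u v => Derive h u * f v).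
  + apply (IH (Derive h) f); auto; now apply smooth1_Derive.
  + apply functional_extensionality; intros a; apply functional_extensionality; intros b.
    symmetry; apply is_derive_unique, Dt.
- replace (fun u v => Derive (fun z => h u * f z) v) with (fun u v => h u * Derive f v).
  + apply (IH h (Derive f)); auto; now apply smooth1_Derive.
  + apply functional_extensionality; intros a; apply functional_extensionality; intros b.
    symmetry; apply is_derive_unique, Dx.
Qed.

Lemma smooth_on_separated h f :
  smooth1 h -> smooth1 f -> smooth_on whole_plane (separated h f).
Proof.
intros Hh Hf; split; [apply open_true|].
assert (H0 : forall n t x, ex_diff_n (fun _ _ => 0) n t x).
{ intros n t x.
  apply (ex_diff_n_ext_loc (fun _ _ => 0 * 0)).
  - exists (mkposreal 1 Rlt_0_1); intros; ring.
  - apply (ex_diff_n_product n (fun _ => 0) (fun _ => 0)); apply smooth1_const. }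
intros [| |] t x _ n; [apply H0 | apply H0 | now apply (ex_diff_n_product n h f)].
Qed.

Definition separated_jet (h f : R -> R) (t x : R) : jetvar -> R :=
  fun v => match v with
  | Jt => t
  | Jx => x
  | Jr r3 k l => Derive_n h k t * Derive_n f l x
  | Jr _ _ _ => 0
  end.

Lemma Derive_n_zero n x : Derive_n (fun _ => 0) n x = 0.
Proof. destruct n; [reflexivity | apply Derive_n_const]. Qed.

Lemma prolong_separated h f t x : prolong (separated h f) t x = separated_jet h f t x.
Proof.
apply functional_extensionality; intros [| |i k l]; try reflexivity.
simpl; unfold partial_derive, separated.
destruct i.
1,2: rewrite (Derive_n_ext _ (fun _ => 0)) by (intros; apply Derive_n_zero); apply Derive_n_zero.
rewrite (Derive_n_ext _ (fun t => h t * Derive_n f l x)) by (intros; apply Derive_n_scal_l).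
apply Derive_n_scal_r.
Qed.

(** Densities may depend on t, so a time has to be fixed; 1 is the time at which the deformation
    ends. *)
Definition static_jet (f : R -> R) : R -> jet := prolong (separated (fun _ => 1) f) 1.

Lemma is_solution_static f : smooth1 f ->
  is_solution whole_plane (separated (fun _ => 1) f).
Proof.
intros Hf; destruct (smooth_on_separated (fun _ => 1) f (smooth1_const 1) Hf) as [HU Hu].
split; [exact HU|]; split; [exact Hu|]; intros i t x _.
rewrite prolong_separated; destruct i; unfold system, velocity, separated_jet; try ring.
rewrite Derive_n_const; ring.
Qed.

Lemma omega_static f t x j : smooth1 f ->
  omega j (prolong (separated (fun _ => 1) f) t x) = Derive_n f j x.
Proof.
intros Hf; assert (Hu := smooth_on_separated (fun _ => 1) f (smooth1_const 1) Hf).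
revert x; induction j as [|j IH]; intros x.
- unfold omega; rewrite prolong_separated; simpl; ring.
- set (z := prolong (separated (fun _ => 1) f) t x).
  change (exp (z (Jr r2 0 0) - z (Jr r1 0 0)) * total_Dx (omega j) z = Derive_n f (S j) x).
  unfold z; rewrite (total_Dx_along whole_plane _ (omega j) t x (Derive_n f (S j) x) Hu I
             (diff_function_omega j)).
  + rewrite prolong_separated; simpl; rewrite Rminus_0_r, exp_0; ring.
  + apply (is_derive_ext (Derive_n f j)); [intros; symmetry; apply IH|].
    apply Derive_correct; now apply smooth1_ex_derive_n.
Qed.

Lemma continuous_along_x u F t x : smooth_on whole_plane u -> diff_function F ->
  continuous (fun s => F (prolong u t s)) x.
Proof.
intros Hu HF; eapply is_derive_continuous; now apply (is_derive_along_x whole_plane).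
Qed.

Lemma ex_RInt_along u F t a b : smooth_on whole_plane u -> diff_function F ->
  ex_RInt (fun x => F (prolong u t x)) a b.
Proof.
intros Hu HF; apply (ex_RInt_continuous (fun x => F (prolong u t x))).
intros x _; now apply continuous_along_x.
Qed.

(** Differentiation under the integral, D_t rho = - D_x sigma, and the fundamental theorem of
    calculus. The divergence vanishes identically, so [u] need not solve the system. *)
Lemma null_divergence_evolution N u t : null_divergence N -> smooth_on whole_plane u ->
  is_derive (fun t => RInt (fun x => fst N (prolong u t x)) 0 1) t
    (snd N (prolong u t 0) - snd N (prolong u t 1)).
Proof.
intros [[HN1 HN2] HN] Hu.
assert (E : RInt (fun x => Derive (fun s => fst N (prolong u s x)) t) 0 1 =
            snd N (prolong u t 0) - snd N (prolong u t 1)).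
{ rewrite (RInt_ext _ (fun x => opp (total_Dx (snd N) (prolong u t x)))).
  - rewrite (RInt_opp (V := R_CompleteNormedModule) (fun x => total_Dx (snd N) (prolong u t x)))
      by (apply ex_RInt_along; auto; now apply diff_function_Dx).
    rewrite (is_RInt_unique _ _ _ _ (is_RInt_derive (fun s => snd N (prolong u t s)) _ 0 1
      (fun x _ => is_derive_along_x whole_plane u (snd N) t x Hu I HN2)
      (fun x _ => continuous_along_x u _ t x Hu (diff_function_Dx _ HN2)))).
    apply Ropp_minus_distr.
  - intros x _.
    transitivity (total_Dt (fst N) (prolong u t x)).
    { now apply is_derive_unique, (is_derive_along_t whole_plane). }
    specialize (HN (prolong u t x)); unfold total_div in HN; unfold opp; simpl; lra. }
rewrite <- E.
apply (is_derive_RInt_param (fun t x => fst N (prolong u t x))).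
- apply filter_forall; intros s x _; eexists; now apply (is_derive_along_t whole_plane).
- intros x _.
  apply (continuity_2d_pt_ext (fun t x => total_Dt (fst N) (prolong u t x))).
  + intros a b; symmetry; apply is_derive_unique; now apply (is_derive_along_t whole_plane).
  + apply (continuous_along whole_plane); auto; [exact I | now apply diff_function_Dt].
- apply filter_forall; intros s; now apply ex_RInt_along.
Qed.

(* The null divergence is integrated along an (off-shell) deformation [h t * f x] of
   the zero function into [f]. *)
Lemma null_divergence_integral N n f : null_divergence N ->
  order_le n (fst N) -> order_le n (snd N) -> smooth1 f ->
  (forall l, (l <= n)%nat -> Derive_n f l 0 = 0) ->
  (forall l, (l <= n)%nat -> Derive_n f l 1 = 0) ->
  RInt (fun x => fst N (static_jet f x)) 0 1 =
  RInt (fun x => fst N (static_jet (fun _ => 0) x)) 0 1.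
Proof.
intros HN O1 O2 Hf F0 F1.
destruct (smooth_step n) as [h [Hh [h0 h1]]].
(* The path [w] of zero functions removes explicit dependence on t: the fluxes of [u] at 0 and 1
   need not vanish, but they agree with those of [w], because f is flat there. *)
set (u := separated h f); set (w := separated h (fun _ => 0)).
assert (Hu : smooth_on whole_plane u) by now apply smooth_on_separated.
assert (Hw : smooth_on whole_plane w)
  by (apply smooth_on_separated; auto; apply smooth1_const).
set (D := fun t => RInt (fun x => fst N (prolong u t x)) 0 1 -
                   RInt (fun x => fst N (prolong w t x)) 0 1).
assert (HD : D 0 = D 1).
{ apply (eq_is_derive D 0 1); [|apply Rlt_0_1]; intros t _.
  assert (Hb : forall x, x = 0 \/ x = 1 -> snd N (prolong u t x) = snd N (prolong w t x)).
  { intros x Hx; apply O2; intros v Hv; unfold u, w; rewrite !prolong_separated.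
    destruct v as [| |[| |] k l]; try reflexivity; simpl in Hv |- *.
    rewrite Derive_n_zero.
    destruct Hx as [-> | ->]; [rewrite F0 | rewrite F1]; auto; lia. }
  change (is_derive D t 0).
  replace 0 with ((snd N (prolong u t 0) - snd N (prolong u t 1)) -
                     (snd N (prolong w t 0) - snd N (prolong w t 1)))
    by (rewrite !Hb by auto; apply Rminus_diag).
  apply (is_derive_Rminus (fun t => RInt (fun x => fst N (prolong u t x)) 0 1)
           (fun t => RInt (fun x => fst N (prolong w t x)) 0 1));
    now apply null_divergence_evolution. }
(* Flatness of [h] at 0 makes the n-jets of [u] and [w] coincide at time 0. *)
assert (E0 : D 0 = 0).
{ apply Rminus_diag_eq, RInt_ext; intros x _; apply O1; intros v Hv.
  unfold u, w; rewrite !prolong_separated.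
  destruct v as [| |[| |] k l]; try reflexivity; simpl in Hv |- *.
  rewrite h0 by lia; ring. }
assert (E1 : forall g, (forall t x, prolong (separated h g) t x = separated_jet h g t x) ->
  forall x, fst N (prolong (separated h g) 1 x) = fst N (static_jet g x)).
{ intros g Hg x; apply O1; intros v Hv; unfold static_jet; rewrite !prolong_separated.
  destruct v as [| |[| |] k l]; try reflexivity; simpl in Hv |- *.
  rewrite h1 by lia; reflexivity. }
rewrite <- (RInt_ext _ _ _ _ (fun x _ => E1 f (prolong_separated h f) x)).
rewrite <- (RInt_ext _ _ _ _ (fun x _ => E1 (fun _ => 0) (prolong_separated h _) x)).
fold u w; unfold D in E0, HD; lra.
Qed.

(** A linear choice would fail: for K > 0 the density e^(r1-r2) omega^K equals D_x omega^(K-1), and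
    the current is trivial. The square gives an integrand of constant sign on static solutions. *)
Definition square_Omega (K : nat) (w : nat -> R) : R := w K * w K.

Lemma admissible_square_Omega K : admissible_Omega (square_Omega K).
Proof.
split; [intros n; apply of_class_C_mult; apply of_class_C_coord|].
exists K; intros z w E; unfold square_Omega; now rewrite (E K (le_n K)).
Qed.

Lemma density_static K f x : smooth1 f ->
  fst (current_C1 (square_Omega K)) (static_jet f x) = Derive_n f K x * Derive_n f K x.
Proof.
intros Hf; set (z := static_jet f x).
change (exp (z (Jr r1 0 0) - z (Jr r2 0 0)) * (omega K z * omega K z) =
        Derive_n f K x * Derive_n f K x).
unfold z, static_jet; rewrite !omega_static, !prolong_separated by auto; simpl.
rewrite Rminus_0_r, exp_0; ring.
Qed.

Lemma smooth_on_static f : smooth1 f -> smooth_on whole_plane (separated (fun _ => 1) f).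
Proof. intros Hf; apply smooth_on_separated; auto; apply smooth1_const. Qed.

(** The required flatness [n] comes from the null divergence in the witness of equivalence; it
    precedes [f], so the test function may depend on it. *)
Lemma equivalent_density_integral K C' :
  diff_current C' -> equivalent_currents (current_C1 (square_Omega K)) C' ->
  exists n, forall f, smooth1 f ->
  (forall l, (l <= n)%nat -> Derive_n f l 0 = 0) ->
  (forall l, (l <= n)%nat -> Derive_n f l 1 = 0) ->
  RInt (fun x => Derive_n f K x * Derive_n f K x -
          (fst C' (static_jet f x) - fst C' (static_jet (fun _ => 0) x))) 0 1 = 0.
Proof.
intros [HC _] [N [Z [HN [[_ [HZ _]] [HE _]]]]].
change (forall z, fst (current_C1 (square_Omega K)) z - fst C' z = fst N z + fst Z z) in HE.
destruct HN as [[[S1 [n1 O1]] [S2 [n2 O2]]] HN0].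
assert (HN : null_divergence N) by (split; auto; split; split; eauto).
exists (n1 + n2)%nat; intros f Hf F0 F1.
assert (E : forall g, smooth1 g -> forall x, fst N (static_jet g x) =
  Derive_n g K x * Derive_n g K x - fst C' (static_jet g x)).
{ intros g Hg x; rewrite <- (density_static K g x Hg).
  assert (H := HE (static_jet g x)).
  assert (H0 : fst Z (static_jet g x) = 0)
    by exact (HZ _ _ (is_solution_static g Hg) 1 x I).
  lra. }
assert (Hz := smooth1_const 0).
rewrite (RInt_ext _ (fun x => fst N (static_jet f x) - fst N (static_jet (fun _ => 0) x))).
- rewrite (RInt_minus (V := R_CompleteNormedModule)
    (fun x => fst N (static_jet f x)) (fun x => fst N (static_jet (fun _ => 0) x))).
  + apply Rminus_diag_eq, (null_divergence_integral N (n1 + n2)); auto;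
      [apply (order_le_weaken n1) | apply (order_le_weaken n2)]; auto; lia.
  + apply ex_RInt_along; [now apply smooth_on_static | apply HN].
  + apply ex_RInt_along; [now apply smooth_on_static | apply HN].
- intros x _; rewrite (E f Hf), (E _ Hz), Derive_n_zero; simpl; ring.
Qed.

(** On static jets the variables with a t-derivative vanish, so only x-derivatives of f up to order
    m enter. Uniformity over [0,1] is an issue because G may depend on x. *)
Lemma density_near_zero G m : diff_function G -> order_le m G ->
  forall eps : posreal, exists d : posreal, forall f x, 0 <= x <= 1 ->
    (forall l, (l <= m)%nat -> Rabs (Derive_n f l x) < d) ->
    Rabs (G (static_jet f x) - G (static_jet (fun _ => 0) x)) < eps.
Proof.
intros [HG _] Hm eps.
destruct (uniform_finite_dep_continuous jetvar_eq_dec (jet_vars m) G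
  (static_jet (fun _ => 0)) 0 1 (order_le_in m G Hm) (proj1 (HG 0%nat))) with (eps := eps) as [d Hd].
{ intros v x _; eapply is_derive_continuous.
  apply (is_derive_prolong true whole_plane); [|exact I].
  apply smooth_on_static, smooth1_const. }
exists d; intros f x Hx Hf; apply Hd; auto.
intros v Hv; apply in_jet_vars in Hv.
unfold static_jet; rewrite !prolong_separated.
destruct v as [| |[| |] k l]; simpl in Hv |- *.
1-4: rewrite Rminus_diag, Rabs_R0; apply cond_pos.
rewrite Derive_n_zero, Rmult_0_r, Rminus_0_r.
destruct k as [|k].
- simpl; rewrite Rmult_1_l; apply Hf; lia.
- rewrite Derive_n_const, Rmult_0_l, Rabs_R0; apply cond_pos.
Qed.

(** * Oscillating solutions and the order of the law *)

Definition bump (n : nat) (x : R) : R := (x * (1 - x)) ^ S n.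

Lemma smooth1_parabola : smooth1 (fun x => x * (1 - x)).
Proof. apply smooth1_mult; [|apply smooth1_one_minus]; apply smooth1_id. Qed.

Lemma smooth1_bump n : smooth1 (bump n).
Proof. exact (smooth1_pow _ (S n) smooth1_parabola). Qed.

Lemma bump_bounds n x : 0 <= x <= 1 -> 0 <= bump n x <= 1.
Proof.
intros H; assert (Hx : 0 <= x * (1 - x) <= 1) by nra.
unfold bump; split; [now apply pow_le|].
generalize (pow_incr _ 1 (S n) Hx); now rewrite pow1.
Qed.

(** The bracketing exhibits a power times a smooth cofactor, the shape treated by
    [Derive_n_at_zero_of_pow]. *)
Definition oscillating (n k : nat) (nu c x : R) : R :=
  bump n x * (sin (nu * x + c) * / nu ^ k).

Lemma smooth1_oscillating n k nu c : smooth1 (oscillating n k nu c).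
Proof.
apply smooth1_mult; [apply smooth1_bump|].
apply smooth1_mult; [apply smooth1_sin_affine | apply smooth1_const].
Qed.

Lemma oscillating_flat n k nu c a l : a * (1 - a) = 0 -> (l <= n)%nat ->
  Derive_n (oscillating n k nu c) l a = 0.
Proof.
intros Ha Hl.
apply (Derive_n_at_zero_of_pow (fun x => x * (1 - x)) (S n) l a smooth1_parabola Ha); [|lia].
apply smooth1_mult; [apply smooth1_sin_affine | apply smooth1_const].
Qed.

Lemma Derive_n_oscillating n k nu c l x :
  Derive_n (oscillating n k nu c) l x = osc l (bump n) nu c x * / nu ^ k.
Proof.
rewrite (Derive_n_ext _ (fun x => (bump n x * sin (nu * x + c)) * / nu ^ k))
  by (intros; unfold oscillating; ring).
rewrite Derive_n_scal_r; f_equal; apply Derive_n_osc, smooth1_bump.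
Qed.

Lemma oscillating_small n k : exists B, 0 <= B /\
  forall nu c x l, 1 <= nu -> 0 <= x <= 1 -> (l <= k)%nat ->
  Rabs (Derive_n (oscillating n (S k) nu c) l x) <= B / nu.
Proof.
destruct (osc_bound_upto k (bump n) (smooth1_bump n)) as [B [HB H]].
exists B; split; auto; intros nu c x l Hnu Hx Hl.
assert (Hp : 0 < nu ^ S k) by (apply pow_lt; lra).
rewrite Derive_n_oscillating, Rabs_mult, (Rabs_pos_eq (/ _))
  by (left; now apply Rinv_0_lt_compat).
replace (B / nu) with (B * nu ^ k * / nu ^ S k)
  by (simpl; field; split; try apply pow_nonzero; lra).
apply Rmult_le_compat_r; [left; now apply Rinv_0_lt_compat | now apply H].
Qed.

Lemma oscillating_leading n k : exists B, 0 <= B /\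
  forall nu c x, 1 <= nu -> 0 <= x <= 1 ->
  Rabs (Derive_n (oscillating n (S k) nu c) (S k) x -
        bump n x * sin (nu * x + c + INR (S k) * (PI / 2))) <= B / nu.
Proof.
destruct (osc_leading k (bump n) (smooth1_bump n)) as [B [HB H]].
exists B; split; auto; intros nu c x Hnu Hx.
assert (Hp : 0 < nu ^ S k) by (apply pow_lt; lra).
specialize (H nu c x Hnu Hx); rewrite Derive_n_oscillating.
set (y := bump n x * sin (nu * x + c + INR (S k) * (PI / 2))) in *.
replace (osc (S k) (bump n) nu c x * / nu ^ S k - y)
  with ((osc (S k) (bump n) nu c x - nu ^ S k * y) * / nu ^ S k) by (field; lra).
rewrite Rabs_mult, (Rabs_pos_eq (/ _)) by (left; now apply Rinv_0_lt_compat).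
replace (B / nu) with (B * nu ^ k * / nu ^ S k)
  by (simpl; field; split; try apply pow_nonzero; lra).
apply Rmult_le_compat_r; [left; now apply Rinv_0_lt_compat | exact H].
Qed.

(** Expand a^2 = b^2 + 2 b (a - b) + (a - b)^2 and drop the last square. *)
Lemma square_lower_bound a b d : Rabs b <= 1 -> Rabs (a - b) <= d ->
  b * b - 2 * d <= a * a.
Proof.
intros Hb Hd.
assert (H : Rabs (b * (a - b)) <= 1 * d)
  by (rewrite Rabs_mult; apply Rmult_le_compat; auto; apply Rabs_pos).
assert (H' := Rle_abs (- (b * (a - b)))); rewrite Rabs_Ropp in H'.
assert (Hs := Rle_0_sqr (a - b)); unfold Rsqr in Hs; lra.
Qed.

(* The phases [0] and [PI / 2] are combined so that sin^2 + cos^2 = 1 makes the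
   leading term independent of [nu]. *)
Lemma oscillating_energy n k : exists B, 0 <= B /\
  forall nu x, 1 <= nu -> 0 <= x <= 1 ->
  bump n x * bump n x - B / nu <=
    Derive_n (oscillating n (S k) nu 0) (S k) x * Derive_n (oscillating n (S k) nu 0) (S k) x +
    Derive_n (oscillating n (S k) nu (PI / 2)) (S k) x *
    Derive_n (oscillating n (S k) nu (PI / 2)) (S k) x.
Proof.
destruct (oscillating_leading n k) as [B [HB H]].
(* Each of the two phases loses 2 B / nu in [square_lower_bound]. *)
exists (4 * B); split; [lra|]; intros nu x Hnu Hx.
set (y := nu * x + 0 + INR (S k) * (PI / 2)).
assert (H1 := H nu 0 x Hnu Hx); assert (H2 := H nu (PI / 2) x Hnu Hx).
fold y in H1.
replace (nu * x + PI / 2 + INR (S k) * (PI / 2)) with (PI / 2 + y) in H2 by (unfold y; ring).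
rewrite <- cos_sin in H2.
assert (Hphi := bump_bounds n x Hx).
assert (Hs : forall s, -1 <= s <= 1 -> Rabs (bump n x * s) <= 1).
{ intros s Hs; rewrite Rabs_mult, <- (Rmult_1_l 1).
  apply Rmult_le_compat; try apply Rabs_pos; apply Rabs_le; lra. }
apply square_lower_bound in H1; [|apply Hs, SIN_bound].
apply square_lower_bound in H2; [|apply Hs, COS_bound].
assert (E : bump n x * sin y * (bump n x * sin y) + bump n x * cos y * (bump n x * cos y) =
            bump n x * bump n x).
{ assert (T := sin2_cos2 y); unfold Rsqr in T.
  replace (bump n x * bump n x) with (bump n x * bump n x * (sin y * sin y + cos y * cos y))
    by (rewrite T; ring).
  ring. }
replace (4 * B / nu) with (2 * (B / nu) + 2 * (B / nu)) by (field; lra).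
lra.
Qed.

Lemma RInt_bump_pos n : 0 < RInt (fun x => bump n x * bump n x) 0 1.
Proof.
apply RInt_gt_0; [apply Rlt_0_1| |].
- intros x Hx; assert (0 < bump n x) by (apply pow_lt; nra); nra.
- intros x _; apply (smooth1_continuous (fun x => bump n x * bump n x)).
  apply smooth1_mult; apply smooth1_bump.
Qed.

Lemma density_order_lower_bound K C' m :
  diff_current C' -> equivalent_currents (current_C1 (square_Omega K)) C' ->
  order_le m (fst C') -> (K <= m)%nat.
Proof.
intros HC Heq Hm; destruct K as [|k]; [lia|].
apply Nat.nlt_ge; intros Hmk.
destruct (equivalent_density_integral (S k) C' HC Heq) as [n Hint].
set (G := fst C') in *.
set (I0 := RInt (fun x => bump n x * bump n x) 0 1).
assert (HI : 0 < I0) by apply RInt_bump_pos.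
(* Error budget: each of the two phases costs less than I0 / 8 through G, and the energy estimate
   costs at most I0 / 4. The total I0 / 2 leaves a positive half of the integral [I0]. *)
assert (He : 0 < I0 / 8) by lra.
destruct (density_near_zero G m (proj1 HC) Hm (mkposreal _ He)) as [d Hd].
simpl in Hd.
destruct (oscillating_small n k) as [B1 [HB1 H1]].
destruct (oscillating_energy n k) as [B2 [HB2 H2]].
assert (Hdp := cond_pos d).
(* The second summand makes the derivatives of order at most k smaller than [d], the third bounds B2
   / nu by I0 / 4, and the 1 gives nu >= 1 and a strict first bound. *)
set (nu := 1 + B1 / d + 4 * B2 / I0).
assert (Hn1 : 0 <= B1 / d) by (apply Rdiv_le_0_compat; lra).
assert (Hn2 : 0 <= 4 * B2 / I0) by (apply Rdiv_le_0_compat; lra).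
assert (Hnu : 1 <= nu) by (unfold nu; lra).
assert (Hs1 : B1 / nu < d).
{ apply Rlt_div_l; [lra|].
  replace B1 with (d * (B1 / d)) at 1 by (field; lra).
  apply Rmult_lt_compat_l; unfold nu; lra. }
assert (Hs2 : B2 / nu <= I0 / 4).
{ apply Rle_div_l; [lra|].
  replace B2 with (I0 / 4 * (4 * B2 / I0)) at 1 by (field; lra).
  apply Rmult_le_compat_l; unfold nu; lra. }
set (f := oscillating n (S k) nu).
set (J := fun c x => Derive_n (f c) (S k) x * Derive_n (f c) (S k) x -
          (G (static_jet (f c) x) - G (static_jet (fun _ => 0) x))).
assert (Hf : forall c, smooth1 (f c)) by (intros c; apply smooth1_oscillating).
assert (HJ : forall c, RInt (J c) 0 1 = 0).
{ intros c; apply Hint; [apply Hf| |]; intros l Hl;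
    apply oscillating_flat; auto; ring. }
assert (HG : forall g x, smooth1 g -> continuous (fun x => G (static_jet g x)) x).
{ intros g x Hg; apply continuous_along_x; [now apply smooth_on_static | apply HC]. }
assert (Hex : forall c, ex_RInt (J c) 0 1).
{ intros c; apply (ex_RInt_continuous (J c)); intros x _.
  apply (continuous_minus (V := R_NormedModule)
    (fun x => Derive_n (f c) (S k) x * Derive_n (f c) (S k) x)
    (fun x => G (static_jet (f c) x) - G (static_jet (fun _ => 0) x))).
  - apply (smooth1_continuous (fun x => Derive_n (f c) (S k) x * Derive_n (f c) (S k) x)).
    apply smooth1_mult; apply smooth1_Derive_n; auto.
  - apply (continuous_minus (V := R_NormedModule)
      (fun x => G (static_jet (f c) x)) (fun x => G (static_jet (fun _ => 0) x)));
      apply HG; auto; apply smooth1_const. }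
assert (Hsum : RInt (fun x => J 0 x + J (PI / 2) x) 0 1 = 0).
{ rewrite (RInt_plus (V := R_CompleteNormedModule) (J 0) (J (PI / 2))) by auto.
  rewrite !HJ; apply Rplus_0_l. }
assert (Hb : ex_RInt (fun x => bump n x * bump n x) 0 1).
{ apply (ex_RInt_continuous (fun x => bump n x * bump n x)); intros x _.
  apply (smooth1_continuous (fun x => bump n x * bump n x)).
  apply smooth1_mult; apply smooth1_bump. }
assert (Hlow : RInt (fun x => bump n x * bump n x - I0 / 2) 0 1 = I0 / 2).
{ rewrite (RInt_minus (V := R_CompleteNormedModule)
    (fun x => bump n x * bump n x) (fun _ => I0 / 2)) by (auto; apply ex_RInt_const).
  rewrite RInt_const; fold I0; unfold minus, plus, opp, scal; simpl; unfold mult; simpl.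
  field. }
assert (Hle : RInt (fun x => bump n x * bump n x - I0 / 2) 0 1 <=
              RInt (fun x => J 0 x + J (PI / 2) x) 0 1).
{ apply RInt_le; [lra| | |].
  - apply (ex_RInt_minus (V := R_NormedModule)
      (fun x => bump n x * bump n x) (fun _ => I0 / 2)); auto; apply ex_RInt_const.
  - apply (ex_RInt_plus (V := R_NormedModule) (J 0) (J (PI / 2))); auto.
  - intros x Hx; assert (Hx' : 0 <= x <= 1) by lra.
    assert (Hclose : forall c,
      Rabs (G (static_jet (f c) x) - G (static_jet (fun _ => 0) x)) < I0 / 8).
    { intros c; apply Hd; auto; intros l Hl.
      eapply Rle_lt_trans; [apply H1; auto; lia | exact Hs1]. }
    assert (Hc0 := Rle_lt_trans _ _ _ (Rle_abs _) (Hclose 0)).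
    assert (Hc1 := Rle_lt_trans _ _ _ (Rle_abs _) (Hclose (PI / 2))).
    specialize (H2 nu x Hnu Hx'); unfold J; fold f in H2; lra. }
(* The integral of J 0 + J (PI / 2) is 0, yet it is at least I0 / 2 > 0. *)
lra.
Qed.

(** * The zero current, reflexivity of equivalence, and the conclusion *)

Lemma zero_current_diff : diff_current zero_current.
Proof. split; exact (diff_function_const 0). Qed.

Lemma zero_current_null_divergence : null_divergence zero_current.
Proof.
split; [apply zero_current_diff|]; intros z.
assert (H : forall b, total b (fun _ : jet => 0) z = 0).
{ intros b; rewrite (total_sum_over b 0) by (intros y w _; reflexivity).
  rewrite (sum_over_ext _ _ (fun _ => 0)).
  - generalize (jet_vars 0); intros l; induction l as [|v l IH]; [reflexivity|].
    rewrite sum_over_cons, IH; ring.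
  - intros v _; rewrite (partial_off_support jetvar_eq_dec (fun _ => False));
      [ring | intros y w _; reflexivity | auto]. }
unfold total_div; simpl.
assert (Ht := H false); assert (Hx := H true); simpl in Ht, Hx.
rewrite Ht, Hx; ring.
Qed.

Lemma equivalent_currents_refl C : equivalent_currents C C.
Proof.
exists zero_current, zero_current; repeat split;
  try apply zero_current_null_divergence;
  try apply zero_current_diff; try (intros U u _ t x _; reflexivity);
  intros z; simpl; ring.
Qed.

Lemma order_le_density K : order_le K (fst (current_C1 (square_Omega K))).
Proof.
apply (order_le_binop Rmult K (fun z => exp (z (Jr r1 0 0) - z (Jr r2 0 0)))
  (fun z => square_Omega K (fun j => omega j z))).
- intros z w E; rewrite !E by (simpl; lia); reflexivity.
- intros z w E; unfold square_Omega; now rewrite (proj2 (smooth_order_omega K) z w E).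
Qed.

Theorem proposition26 :
  (forall Om : (nat -> R) -> R,
     admissible_Omega Om -> conserved_current (current_C1 Om)) /\
  (forall N : nat, exists Om : (nat -> R) -> R,
     admissible_Omega Om /\
     nontrivial_law (current_C1 Om) /\
     exists m : nat, (N <= m)%nat /\ law_order (current_C1 Om) m).
Proof.
split; [exact current_C1_conserved|].
(* The successor keeps the order positive even for N = 0, so that the same lower bound also gives
   nontriviality. *)
intros N; exists (square_Omega (S N)).
assert (HO := admissible_square_Omega (S N)).
assert (HC := current_C1_conserved _ HO).
split; [exact HO|]; split.
- intros Heq.
  (* Were the law trivial, the zero density, of order at most 0, would represent it, and the bound
     would read S N <= 0. *)
  assert (H := density_order_lower_bound (S N) zero_current 0 zero_current_diff Heq
                 (fun z w _ => eq_refl)).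
  lia.
- exists (S N); split; [lia|]; split.
  + exists (current_C1 (square_Omega (S N))); split; [exact HC|].
    split; [apply equivalent_currents_refl|]; split; [apply order_le_density|].
    intros m Hm; apply (density_order_lower_bound _ (current_C1 (square_Omega (S N))));
      [apply HC | apply equivalent_currents_refl | exact Hm].
  + intros C' m HC' Heq [Hm _].
    apply (density_order_lower_bound _ C'); [apply HC' | exact Heq | exact Hm].
Qed.
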